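(* Let $p\ge 2$ be real, let $x$ be real with $x+1>0$, and let $s$ be complex with $\Re(s)>0$. Then $$\sum_{n=1}^\infty\frac{D(\lambda_{s,x})(n)}{n\,p^n}=\mathcal Z^1_p(s;x)=\sum_{n=1}^\infty\frac{(-1)^{n+1}H_n^{(s)}(x)}{n(p-1)^n}.$$ In particular, if $s=m+1$ with $m$ a nonnegative integer, then $$\sum_{n=1}^\infty\frac{B(n,1+x)}{n\,p^n}P_m\left(H_n^{(1)}(x),\ldots,H_n^{(m)}(x)\right)=\sum_{n=1}^\infty\frac{(-1)^{n+1}H_n^{(m+1)}(x)}{n(p-1)^n}.$$
   Context: For real $x>-1$, $p\ge 1$ and $\Re(s)>0$, $$\mathcal Z^1_p(s;x)=\frac1{\Gamma(s)}\int_0^\infty\frac{e^{-xt}}{e^t-1}\,Li_1\left(\frac{1-e^{-t}}p\right)t^{s-1}\,dt,\qquad Li_1(z)=\sum_{n\ge1}\frac{z^n}{n}.$$ $\lambda_{s,x}(t)=\dfrac{e^{-xt}t^{s-1}}{\Gamma(s)}$ for $t>0$, and for a function $f$ on $(0,\infty)$, $$D(f)(u)=\int_0^\infty\frac{(1-e^{-t})^u}{e^t-1}f(t)\,dt.$$ $H_n^{(s)}(x)=\sum_{j=1}^n(j+x)^{-s}$; $B(\cdot,\cdot)$ is the Euler beta function; the modified Bell polynomials are defined by $\exp\left(\sum_{k\ge1}\frac{x_k}{k}z^k\right)=\sum_{m\ge0}P_m(x_1,\ldots,x_m)z^m$. Infinite series over $n$ are limits of partial sums (for $p=2$ the series on the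 right may converge only conditionally). *)

(* Defs.v *)
From HB Require Import structures.
From mathcomp Require Import all_boot all_order all_algebra.
From mathcomp Require Export complex.
From mathcomp Require Import all_classical all_reals all_analysis.

Set Implicit Arguments.
Unset Strict Implicit.
Unset Printing Implicit Defensive.

Import Order.TTheory GRing.Theory Num.Theory.
Import numFieldNormedType.Exports.

Local Open Scope classical_set_scope.
Local Open Scope ring_scope.
Local Open Scope complex_scope.

(* The sum of F 1 + F 2 + ... is l, as a limit of partial sums (conditional
   convergence allowed). On R[i] the topology is that of the modulus. *)
Definition is_sum (K : numFieldType) (F : nat -> K) (l : K) : Prop :=
  (fun N : nat => \sum_(1 <= n < N.+1) F n) @ \oo --> l.

Section Complex.
Context {R : realType}.
Implicit Types (s z : R[i]) (p t u x : R).

(* t ^ z = exp (z ln t), principal value; only meaningful for 0 < t. *)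
Definition cpow t z : R[i] :=
  (t `^ complex.Re z)%:C
    * (cos (complex.Im z * ln t) +i* sin (complex.Im z * ln t)).

Definition cintegral (A : set R) (f : R -> R[i]) : R[i] :=
  Rintegral lebesgue_measure A (fun t => complex.Re (f t))
    +i* Rintegral lebesgue_measure A (fun t => complex.Im (f t)).

Definition Gamma s : R[i] :=
  cintegral `]0, +oo[ (fun t => (expR (- t))%:C * cpow t (s - 1)).

Definition Beta (a b : R) : R :=
  Rintegral lebesgue_measure `]0, 1[
    (fun t => t `^ (a - 1) * (1 - t) `^ (b - 1)).

Definition Li1 (z : R) : R :=
  limn (fun N : nat => \sum_(1 <= n < N.+1) z ^+ n / n%:R).

Definition Z1 p s x : R[i] :=
  (Gamma s)^-1 *
  cintegral `]0, +oo[ (fun t =>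
    (expR (- (x * t)) / (expR t - 1) * Li1 ((1 - expR (- t)) / p))%:C
      * cpow t (s - 1)).

Definition lambda s x t : R[i] :=
  (expR (- (x * t)))%:C * cpow t (s - 1) / Gamma s.

Definition D (f : R -> R[i]) u : R[i] :=
  cintegral `]0, +oo[ (fun t =>
    ((1 - expR (- t)) `^ u / (expR t - 1))%:C * f t).

Definition H (n : nat) s x : R[i] :=
  \sum_(1 <= j < n.+1) cpow (j%:R + x) (- s).

End Complex.

Section Bell.
Context {F : numFieldType}.
Implicit Types (x : nat -> F) (m N : nat).

Definition bell_inner N x : {poly F} :=
  \sum_(1 <= k < N.+1) (x k / k%:R) *: 'X^k.

(* exp (\sum_(k >= 1) (x k / k) z^k), with both the exponential series and the
   inner series cut after order N; the terms cut off have z-order > N. *)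
Definition bell_gen N x : {poly F} :=
  \sum_(0 <= j < N.+1) (j`!%:R)^-1 *: bell_inner N x ^+ j.

(* P_m(x 1, ..., x m): the coefficient of z^m in the generating function. *)
Definition bell m x : F := (bell_gen m x)`_m.

Lemma bell_inner_factor N x : exists q : {poly F}, bell_inner N x = q * 'X.
Proof.
exists (\sum_(1 <= k < N.+1) (x k / k%:R) *: 'X^(k.-1)).
rewrite /bell_inner mulr_suml; apply: eq_big_nat => -[//|k] _.
by rewrite -scalerAl exprSr.
Qed.

Lemma bell_inner_stable m N x : (m <= N)%N ->
  exists q : {poly F}, bell_inner N x = bell_inner m x + q * 'X^(m.+1).
Proof.
move=> mN; exists (\sum_(m.+1 <= k < N.+1) (x k / k%:R) *: 'X^(k - m.+1)).
rewrite /bell_inner (@big_cat_nat _ _ _ m.+1) //=; congr (_ + _).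
rewrite mulr_suml; apply: eq_big_nat => k /andP[mk _].
by rewrite -scalerAl -exprD subnK.
Qed.

(* The cut-off is immaterial: bell m x is the z^m-coefficient of the
   generating function whatever the order N >= m of the truncation. *)
Lemma bell_genE m N x : (m <= N)%N -> (bell_gen N x)`_m = bell m x.
Proof.
move=> mN; rewrite /bell /bell_gen !coef_sum.
rewrite (@big_cat_nat _ _ _ m.+1) //= [X in _ + X]big1_seq ?addr0; last first.
  move=> j /andP[_]; rewrite mem_index_iota => /andP[mj _].
  have [q ->] := bell_inner_factor N x.
  by rewrite coefZ exprMn coefMXn mj mulr0.
apply: eq_big_nat => j _; rewrite !coefZ; congr (_ * _).
have [q ->] := bell_inner_stable x mN.
suff: forall i, (i <= m)%N ->
  ((bell_inner m x + q * 'X^(m.+1)) ^+ j)`_i = (bell_inner m x ^+ j)`_i.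
  by apply.
elim: j => [|j IH] i im; first by rewrite !expr0.
rewrite ![_ ^+ j.+1]exprS !coefM; apply: eq_bigr => k _; congr (_ * _).
  by rewrite coefD coefMXn ltnS (leq_trans _ im) ?addr0 // -ltnS.
by apply: IH; rewrite (leq_trans _ im) // leq_subr.
Qed.

End Bell.

(* Main.v *)
Require Import Defs.
From mathcomp Require Import all_boot all_order all_algebra.
From mathcomp Require Import complex.
From mathcomp Require Import all_classical all_reals all_analysis.
From mathcomp Require Import measurable_realfun.
From mathcomp Require Import ring lra.
Import Order.TTheory GRing.Theory Num.Theory.
Import numFieldNormedType.Exports.
Local Open Scope classical_set_scope.
Local Open Scope ring_scope.
Local Open Scope complex_scope.

Set Implicit Arguments.
Unset Strict Implicit.
Unset Printing Implicit Defensive.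

(** Write a = x + 1 and w = exp(-t). Up to the factor 1 / Gamma s, everything in the theorem is
    the integral over t > 0 of g(t) t^(s-1) for some real g of size O(exp(-a t)), and equal
    functions g give equal sums.

    Since Li1 (z) = - ln (1 - z), the function g of Z1 is
      exp(-x t) / (exp t - 1) * - ln ((p - 1 + w) / p).
    Two expansions of this logarithm give the two series. Expanding Li1 in powers of (1 - w)/p
    yields the terms D(lambda)(n) / (n p^n). Writing it instead as the difference
    ln (1 + 1/q) - ln (1 + w/q) with q = p - 1 yields (-1)^(n+1) (1 - w^n) / (n q^n), and the
    factor 1 - w^n is a geometric sum, whose integral is H_n by
      int exp(-b t) t^(s-1) dt = Gamma s * b^-s                      (mellin_expR).
    Both expansions evaluate the logarithmic series in [-1, 1/2], where all its partial
    sums are 2-Lipschitz (log_poly_lipschitz) and where they converge, at -1 included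
    (log_poly_cvg). The Lipschitz bound gives a factor 1 - w, which cancels the pole of
    1 / (exp t - 1), so that dominated convergence applies to the partial sums even when
    p = 2 (is_sum_mellin, is_sum_D, is_sum_H).

    To obtain H_n one divides by Gamma s, which is therefore shown not to vanish for Re s > 0
    (Gamma_neq0). Otherwise t^(s-1) exp(-t) would be orthogonal to all polynomials in
    exp(-b t), hence, by approximating steps, have integral 0 on every half-line; but just to
    the right of t = 1 its real part is positive.

    For s = m + 1, expanding (1 - w)^(n-1) turns D(lambda)(n) into
      sum_k (-1)^k C(n-1, k) (a + k)^-(m+1),
    and B(n, a) is the same sum with m = 0. The quotient of the two is the complete symmetric
    function of degree m of 1/a, ..., 1/(a+n-1): both satisfy the recursion that adjoins one
    variable. Newton's identities, which follow from the definition of P_m through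
    exp (sum x_k z^k / k), identify it with P_m of the power sums H_n^(k) (diff_pow_bell). *)

(** * Bell polynomials and finite differences of powers *)

Section Algebra.
Context {F : numFieldType}.
Implicit Types (x h : nat -> F) (a y : F) (n m k : nat).

Lemma coef_deriv_bell_inner N x k : (k < N)%N ->
  ((bell_inner N x)^`())`_k = x k.+1.
Proof.
move=> kN; rewrite coef_deriv /bell_inner coef_sum.
rewrite (bigD1_seq k.+1) ?mem_index_iota ?iota_uniq //=.
rewrite big1_seq => [|j /andP[jk _]]; last first.
  by rewrite coefZ coefXn eq_sym (negPf jk) mulr0.
by rewrite addr0 coefZ coefXn eqxx mulr1 -[_ *+ _]mulr_natr divfK // pnatr_eq0.
Qed.

Lemma deriv_bell_gen N x : (bell_gen N x)^`() =
  (bell_gen N x - (N`!%:R)^-1 *: bell_inner N x ^+ N) * (bell_inner N x)^`().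
Proof.
have -> : bell_gen N x - (N`!%:R)^-1 *: bell_inner N x ^+ N =
    \sum_(0 <= j < N) (j`!%:R)^-1 *: bell_inner N x ^+ j.
  by rewrite /bell_gen big_nat_recr //= addrK.
rewrite /bell_gen raddf_sum big_nat_recl //= derivZ expr0 derivC scaler0 add0r.
rewrite mulr_suml; apply: eq_bigr => j _.
rewrite derivZ deriv_exp /= -scalerAl [_ * bell_inner _ _ ^+ _]mulrC -[(_ * _) *+ _]scaler_nat.
by rewrite scalerA factS natrM invfM mulrAC mulVf ?pnatr_eq0 // mul1r.
Qed.

(** Comparing coefficients in G' = G I' with G = exp I: the truncated exponential only
    misses I^N I' / N!, whose order is at least N. *)
Lemma bell_newton x m :
  m%:R * bell m x = \sum_(k < m) x k.+1 * bell (m - k.+1) x.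
Proof.
case: m => [|m]; first by rewrite mul0r big_ord0.
have := congr1 (fun p : {poly F} => p`_m) (deriv_bell_gen m.+1 x).
rewrite coef_deriv bell_genE // mulr_natl => ->.
rewrite mulrBl coefB -scalerAl coefZ.
have [q qE] := bell_inner_factor m.+1 x.
rewrite [in X in _ - X]qE exprMn mulrAC coefMXn ltnSn mulr0 subr0.
rewrite mulrC coefM; apply: eq_bigr => k _.
by rewrite coef_deriv_bell_inner // bell_genE ?subSS // ltnW // ltnS leq_subr.
Qed.

Lemma bell0 x : bell 0 x = 1.
Proof.
by rewrite /bell /bell_gen big_nat1 expr0 invr1 scale1r coef1.
Qed.

(** Newton's identities determine the sequence, since m is invertible: this is how a closed
    form is recognised as a Bell polynomial. *)
Lemma newton_bell x h : h 0%N = 1 ->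
  (forall m, m%:R * h m = \sum_(k < m) x k.+1 * h (m - k.+1)%N) ->
  forall m, bell m x = h m.
Proof.
move=> h0 hN m; have [n] := ubnP m; elim: n m => // n IH [|m] mn.
  by rewrite bell0 h0.
apply: (mulfI (x := m.+1%:R)); first by rewrite pnatr_eq0.
rewrite bell_newton hN; apply: eq_bigr => k _; rewrite IH //.
by rewrite subSS (leq_ltn_trans (leq_subr _ _)).
Qed.

(** The relation between h and h' says that the generating function of h is multiplied
    by 1/(1 - y z), whose logarithm has the coefficients y^k / k: the power sums gain y^k.
    This is how complete symmetric functions change when the variable y is adjoined. *)
Lemma newton_step (p h h' : nat -> F) y :
  h' 0%N = h 0%N -> (forall m, h' m.+1 = h m.+1 + y * h' m) ->
  (forall m, m%:R * h m = \sum_(k < m) p k.+1 * h (m - k.+1)%N) ->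
  forall m, m%:R * h' m = \sum_(k < m) (p k.+1 + y ^+ k.+1) * h' (m - k.+1)%N.
Proof.
move=> h'0 h'S hN; elim=> [|m IH]; first by rewrite mul0r big_ord0.
have -> : m.+1%:R * h' m.+1 = m.+1%:R * h m.+1 + (y * (m%:R * h' m) + y * h' m).
  by rewrite h'S -natr1; ring.
rewrite hN IH.
under [RHS]eq_bigr do rewrite mulrDl.
rewrite big_split /= [X in X + _ = _]big_ord_recr [X in _ = X + _]big_ord_recr /=.
rewrite [X in _ = _ + X]big_ord_recl /= subnn h'0.
have -> : \sum_(k < m) p k.+1 * h' (m.+1 - k.+1)%N =
    \sum_(k < m) p k.+1 * h (m.+1 - k.+1)%N + y * \sum_(k < m) p k.+1 * h' (m - k.+1)%N.
  rewrite mulr_sumr -big_split /=; apply: eq_bigr => k _.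
  by rewrite !subSS -(subnSK (ltn_ord k)) h'S; ring.
have -> : \sum_(k < m) (p k.+1 + y ^+ k.+1) * h' (m - k.+1)%N =
    \sum_(k < m) p k.+1 * h' (m - k.+1)%N + \sum_(k < m) y ^+ k.+1 * h' (m - k.+1)%N.
  by rewrite -big_split /=; apply: eq_bigr => k _; rewrite mulrDl.
rewrite subn1 /= expr1.
have -> : \sum_(i < m) y ^+ (bump 0 i).+1 * h' (m.+1 - (bump 0 i).+1)%N
   = y * \sum_(k < m) y ^+ k.+1 * h' (m - k.+1)%N.
  by rewrite mulr_sumr; apply: eq_bigr => k _; rewrite /bump /= add1n subSS exprS mulrA.
ring.
Qed.

Lemma coef_1subXn n k : ((1 - 'X) ^+ n : {poly F})`_k = (-1) ^+ k * 'C(n, k)%:R.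
Proof.
rewrite exprBn coef_sum.
under eq_bigr => i _ do
  rewrite coefMn expr1n mulr1 -(rmorphN1 polyC) -rmorphXn /= coefCM coefXn.
have [kn|kn] := ltnP k n.+1.
  rewrite (bigD1 (Ordinal kn)) //= eqxx mulr1 big1 ?addr0 ?mulr_natr // => i /eqP ik.
  by case: eqVneq => [ki|]; rewrite ?mulr0 ?mul0rn //; case: ik; apply: val_inj.
rewrite big1 => [|i _]; first by rewrite bin_small // mulr0.
by rewrite gtn_eqF ?mulr0 ?mul0rn // (leq_trans _ kn).
Qed.

Lemma size_1subXn n : (size ((1 - 'X) ^+ n : {poly F}) <= n.+1)%N.
Proof. by apply/leq_sizeP => k nk; rewrite coef_1subXn bin_small // mulr0. Qed.

(** Up to the sign (-1)^n, the n-th finite difference of b |-> b^-m at a. For m > 0 it is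
    also the integral of exp(-a t) (1 - exp(-t))^n t^(m-1) / (m-1)! over t > 0. *)
Definition diff_pow n m a : F :=
  \sum_(k < n.+1) ((1 - 'X) ^+ n : {poly F})`_k * (a + k%:R) ^- m.

(** Split a + n + 1 as (a + k) + (n + 1 - k) in the k-th term: the first part lowers the
    exponent of a + k, the second turns C(n+1, k) into (n+1) C(n, k). *)
Lemma diff_powS n m a : (forall k, a + k%:R != 0) ->
  (a + n.+1%:R) * diff_pow n.+1 m.+1 a
  = diff_pow n.+1 m a + n.+1%:R * diff_pow n m.+1 a.
Proof.
move=> a0.
have -> : diff_pow n m.+1 a =
    \sum_(k < n.+2) ((1 - 'X) ^+ n : {poly F})`_k * (a + k%:R) ^- m.+1.
  by rewrite big_ord_recr /= coef_1subXn bin_small // mulr0 mul0r addr0.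
rewrite /diff_pow !mulr_sumr -big_split /=; apply: eq_bigr => k _.
rewrite !coef_1subXn.
have -> : (a + k%:R) ^- m = (a + k%:R) * (a + k%:R) ^- m.+1.
  by rewrite exprS invfM mulVKf.
rewrite !mulrA -mulrDl; congr (_ * _).
have /(congr1 (fun i => i%:R : F)) := mul_bin_down n.+1 k.
rewrite /= !natrM natrB -1?ltnS // => e.
by rewrite [n.+1%:R * _ * _]mulrAC e; ring.
Qed.

Lemma diff_pow0 n a : diff_pow n.+1 0 a = 0.
Proof.
have := exprBn (1 : F) 1 n.+1; rewrite subrr exprS mul0r => ->.
apply: eq_bigr => k _.
by rewrite coef_1subXn expr0 invr1 !expr1n !mulr1 mulr_natr.
Qed.

(** By diff_powS, going from n to n+1 adjoins the variable 1/(a+n+1) in the sense of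
    newton_step: the quotients are the complete symmetric functions of 1/a, ..., 1/(a+n). *)
Lemma diff_pow_newton n a (h := fun m => diff_pow n m.+1 a / diff_pow n 1 a)
    (p := fun k => \sum_(0 <= j < n.+1) (a + j%:R) ^- k) :
  (forall k, a + k%:R != 0) ->
  diff_pow n 1 a != 0 /\ forall m, m%:R * h m = \sum_(k < m) p k.+1 * h (m - k.+1)%N.
Proof.
rewrite {}/h {}/p => a0; elim: n => [|n [d0 IH]].
  have dE m : diff_pow 0 m a = a ^- m.
    by rewrite /diff_pow big_ord1 expr0 coef1 mul1r addr0.
  have {}a0 : a != 0 by have := a0 0%N; rewrite addr0.
  rewrite dE expr1 invr_eq0; split=> // m.
  under eq_bigr => k _.
    rewrite big_nat1 addr0 !dE.
    have -> : a ^- k.+1 * (a ^- (m - k.+1).+1 / a^-1) = a ^- m.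
      rewrite -!exprVn [_ ^+ (_ - _).+1]exprSr mulfK ?invr_eq0 // -exprD.
      by rewrite subnKC.
    over.
  rewrite /= sumr_const card_ord dE -[RHS]mulr_natl; congr (_ * _).
  by rewrite -!exprVn exprSr mulfK ?invr_eq0.
have S0 := a0 n.+1.
have d'E : diff_pow n.+1 1 a = n.+1%:R / (a + n.+1%:R) * diff_pow n 1 a.
  apply: (mulfI S0); rewrite diff_powS // diff_pow0 add0r; field.
  by rewrite nat1r.
have d'0 : diff_pow n.+1 1 a != 0.
  by rewrite d'E !mulf_neq0 ?invr_eq0 ?pnatr_eq0.
split=> // m.
under eq_bigr do rewrite big_nat_recr //= -exprVn.
apply: (newton_step (h := fun m => diff_pow n m.+1 a / diff_pow n 1 a)
  (h' := fun m => diff_pow n.+1 m.+1 a / diff_pow n.+1 1 a)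
  (p := fun k => \sum_(0 <= j < n.+1) (a + j%:R) ^- k) _ _ IH).
  by rewrite !divff.
move=> {}m.
have -> : diff_pow n.+1 m.+2 a =
    (diff_pow n.+1 m.+1 a + n.+1%:R * diff_pow n m.+2 a) / (a + n.+1%:R).
  by rewrite -diff_powS // mulrC mulKf.
rewrite d'E; field.
by rewrite d0 !nat1r S0 pnatr_eq0.
Qed.

Lemma diff_pow_bell n m a : (forall k, a + k%:R != 0) ->
  diff_pow n m.+1 a =
  diff_pow n 1 a * bell m (fun k => \sum_(0 <= j < n.+1) (a + j%:R) ^- k).
Proof.
move=> a0; have [d0 hN] := diff_pow_newton n a0.
by rewrite (newton_bell _ hN) ?divff // mulrC divfK.
Qed.
End Algebra.

(** * Partial sums of the logarithmic series on [-1, 1/2] *)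

Section LogSeries.
Context {R : realType}.
Implicit Types (u v z : R) (N : nat).

Definition log_poly N : {poly R} := \sum_(1 <= n < N.+1) n%:R^-1 *: 'X^n.

Lemma horner_log_poly N v : (log_poly N).[v] = \sum_(1 <= n < N.+1) v ^+ n / n%:R.
Proof.
rewrite /log_poly horner_sum; apply: eq_bigr => n _.
by rewrite hornerZ hornerXn mulrC.
Qed.

Lemma log_poly0 N : (log_poly N).[0] = 0.
Proof.
rewrite horner_log_poly big_nat_cond big1 // => n /andP[/andP[n1 _] _].
by rewrite expr0n gtn_eqF // mul0r.
Qed.

Lemma deriv_log_poly N v : (1 - v) * (log_poly N)^`().[v] = 1 - v ^+ N.
Proof.
have -> : (log_poly N)^`() = \sum_(0 <= n < N) 'X^n.
  rewrite /log_poly raddf_sum /= big_add1 /=; apply: eq_bigr => n _.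
  by rewrite derivZ derivXn -['X^_ *+ _]scaler_nat scalerA mulVf ?scale1r ?pnatr_eq0.
elim: N => [|N IH]; first by rewrite big_nil horner0 mulr0 expr0 subrr.
rewrite big_nat_recr //= hornerD mulrDr IH hornerXn exprS; ring.
Qed.

(** The derivative (1 - c^N) / (1 - c) lies between 0 and 2 on [-1, 1/2], whatever N. *)
Lemma log_poly_lipschitz N u v : -1 <= u <= 2^-1 -> -1 <= v <= 2^-1 ->
  `|(log_poly N).[u] - (log_poly N).[v]| <= 2 * `|u - v|.
Proof.
wlog vu : u v / v <= u => [H hu hv|].
  by have [|/ltW] := leP v u; [|rewrite distrC [X in 2 * X]distrC]; move=> /H; apply.
move=> /andP[u1 u2] /andP[v1 v2].
have [//||c cuv ->] := @MVT_segment R (horner (log_poly N)) (horner (log_poly N)^`()) v u.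
- by apply: continuous_subspaceT; exact: continuous_horner.
rewrite normrM ler_wpM2r ?normr_ge0 //.
move: cuv; rewrite in_itv /= => /andP[vc cu].
have c1 : 0 < 1 - c by lra.
have -> : (log_poly N)^`().[c] = (1 - c ^+ N) / (1 - c).
  by rewrite -deriv_log_poly mulrAC divff ?mul1r ?lt0r_neq0.
rewrite ler_norml.
have : `|c ^+ N| <= 1.
  by rewrite normrX exprn_ile1 // ler_norml; lra.
have : 0 <= c -> c ^+ N <= 1 /\ 0 <= c ^+ N.
  by move=> c0; rewrite exprn_ile1 ?exprn_ge0 //; lra.
rewrite ler_norml => cN /andP[cN1 cN2].
rewrite lerNl -mulNr !ler_pdivrMr //.
have [c0|c0] := leP 0 c; last by lra.
by have := cN c0; lra.
Qed.

Lemma is_derive_log_poly_error N (u : R) : u < 1 ->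
  is_derive u 1 (fun t : R => ln (1 - t) + (log_poly N).[t]) (- (u ^+ N / (1 - u))).
Proof.
move=> u1; have u1' : 0 < 1 - u by rewrite subr_gt0.
have dl : is_derive u 1 (fun t : R => 1 - t) (-1).
  by apply: is_derive_eq; ring.
have dln : is_derive u 1 (fun t : R => ln (1 - t)) ((1 - u)^-1 * -1).
  by apply: (@is_derive1_comp _ (@ln R) (fun t : R => 1 - t)); exact: is_derive1_ln.
apply: is_derive_eq.
have -> : (log_poly N)^`().[u] = (1 - u ^+ N) / (1 - u).
  by rewrite -deriv_log_poly mulrAC divff ?mul1r ?lt0r_neq0.
by field; rewrite lt0r_neq0.
Qed.

(** Along the segment from 0 to v the error has derivative -v (v t)^N / (1 - v t), which is
    at most 2 t^N: this is uniform in v, hence covers the endpoint -1. *)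
Lemma log_poly_error N v : -1 <= v <= 2^-1 ->
  `|(log_poly N).[v] + ln (1 - v)| <= 2 / N.+1%:R.
Proof.
move=> /andP[v1 v2].
suff key (e : R) : `|e| = 1 -> 0 <= 2 / N.+1%:R + e * (ln (1 - v) + (log_poly N).[v]).
  have := key 1 (normr1 _); have := key (-1) (normrN1 _).
  rewrite mul1r mulN1r subr_ge0 => h1 h2.
  by rewrite addrC ler_norml h1 andbT lerNl -subr_ge0 opprK.
move=> e1.
pose g (t : R) := ln (1 - t) + (log_poly N).[t].
pose f (t : R) := 2 / N.+1%:R * t ^+ N.+1 + e * g (v * t).
pose df (t : R) := 2 * t ^+ N - e * v * ((v * t) ^+ N / (1 - v * t)).
have vt (t : R) : t \in `[0, 1] -> v * t <= 2^-1.
  rewrite in_itv /= => /andP[t0 t1]; have [v0|/ltW v0] := leP 0 v.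
    exact: le_trans (ler_piMr v0 t1) v2.
  by have := mulr_le0_ge0 v0 t0; lra.
have fd (t : R) : t \in `[0, 1] -> is_derive t 1 f (df t).
  move=> /vt vt1.
  have dv : is_derive t 1 (fun t : R => v * t) v.
    by apply: is_derive_eq; rewrite /GRing.scale /= mulr1.
  have dg : is_derive t 1 (fun t : R => g (v * t)) (- ((v * t) ^+ N / (1 - v * t)) * v).
    apply: (@is_derive1_comp _ g (fun t : R => v * t)).
    by apply: is_derive_log_poly_error; lra.
  have dX : is_derive t 1 (fun t : R => t ^+ N.+1) (N.+1%:R * t ^+ N).
    have := is_deriveX N.+1 (is_derive_id t (1 : R)).
    by rewrite exprfctE /GRing.scale /= mulr1.
  apply: (is_derive_eq (is_deriveD (is_deriveZ (2 / N.+1%:R) dX) (is_deriveZ e dg))).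
  have vt0 : 1 - v * t != 0 by rewrite lt0r_neq0 //; lra.
  rewrite /df /GRing.scale /=; field; by rewrite nat1r pnatr_eq0 vt0.
have cf : {within `[0, 1], continuous f}.
  by apply: derivable_within_continuous => t t01; have /@ex_derive := fd _ t01.
have fd' (t : R) : t \in `]0, 1[ -> is_derive t 1 f (df t).
  move=> t01; apply: fd; move: t01.
  by rewrite !in_itv /= => /andP[/ltW -> /ltW ->].
have [c c01] := MVT_segment ler01 fd' cf.
have f0 : f 0 = 0.
  by rewrite /f /g expr0n /= mulr0 add0r mulr0 subr0 ln1 log_poly0 addr0 mulr0.
rewrite f0 !subr0 mulr1 => f1.
have : f 1 = 2 / N.+1%:R + e * (ln (1 - v) + (log_poly N).[v]).
  by rewrite /f /g expr1n !mulr1.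
move=> <-; rewrite f1 /df subr_ge0.
have vc1 : 0 < 1 - v * c by have := vt c c01; lra.
have /andP[c0 c1] : 0 <= c <= 1 by move: c01; rewrite in_itv.
rewrite (le_trans (ler_norm _)) // !normrM e1 mul1r normfV (gtr0_norm vc1).
rewrite normrX normrM (ger0_norm c0) exprMn.
have nv1 : `|v| <= 1 by rewrite ler_norml; lra.
have -> : `|v| * (`|v| ^+ N * c ^+ N / (1 - v * c)) =
    `|v| ^+ N * (`|v| / (1 - v * c)) * c ^+ N by ring.
rewrite ler_wpM2r ?exprn_ge0 // (@le_trans _ _ (1 * 2)) ?mul1r //.
rewrite -[leRHS]mul1r ler_pM ?exprn_ge0 ?divr_ge0 ?normr_ge0 ?(ltW vc1) ?exprn_ile1 //.
by rewrite ler_pdivrMr //; have := vt c c01; lra.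
Qed.

Lemma log_poly_cvg v : -1 <= v <= 2^-1 ->
  (fun N => (log_poly N).[v]) @ \oo --> - ln (1 - v).
Proof.
move=> hv; have h0 : (fun N => 2 / N.+1%:R : R) @ \oo --> (0 : R).
  by rewrite -(mulr0 2); apply: cvgM; [exact: cvg_cst|exact: cvg_harmonic].
apply/cvgrPdist_le => e e0; move/cvgrPdist_le: h0 => /(_ e e0).
apply: filterS => N; rewrite sub0r normrN ger0_norm // => h.
by rewrite distrC opprK (le_trans (log_poly_error _ hv)).
Qed.

Lemma Li1E v : -1 <= v <= 2^-1 -> Li1 v = - ln (1 - v).
Proof.
move=> hv; rewrite /Li1; under eq_fun do rewrite -horner_log_poly.
by apply/cvg_lim => //; exact: log_poly_cvg.
Qed.
End LogSeries.

(** * Real integrals *)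

Section RealIntegrals.
Context {R : realType}.
Notation mu := (@lebesgue_measure R).
Implicit Types (f F : R -> R) (a t c : R).

(** The integrand may be singular at both ends: the fundamental theorem of calculus
    on each segment and monotone convergence suffice. *)
Lemma ge0_FTC2_bigcup f F (u v : nat -> R) (S : set R) (l : R) :
  (forall n, u n < v n) -> nonincreasing_seq u -> nondecreasing_seq v ->
  S = \bigcup_n `[u n, v n]%classic ->
  (forall t, S t -> 0 <= f t) ->
  (forall t, S t -> {for t, continuous f}) ->
  (forall t, S t -> is_derive t 1 F (f t)) ->
  (fun n => F (v n) - F (u n)) @ \oo --> l ->
  (\int[mu]_(t in S) (f t)%:E = l%:E)%E.
Proof.
move=> uv ud vi SE f0 cf dF Fl.
have sub n t : `[u n, v n]%classic t -> S t by rewrite SE; exists n.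
have cI n : {within `[u n, v n], continuous f}.
  by apply: continuous_in_subspaceT => t /set_mem /sub; exact: cf.
have I n : (\int[mu]_(t in `[u n, v n]) (f t)%:E = (F (v n) - F (u n))%:E)%E.
  rewrite (@continuous_FTC2 _ f F) //.
  - have dFn t : t \in `[u n, v n] -> derivable F t 1.
      by move=> /sub /dF /@ex_derive.
    have cFn t : t \in `[u n, v n] -> {for t, continuous F}.
      by move=> /dFn /derivable1_diffP /differentiable_continuous.
    split.
    + by move=> t /subset_itv_oo_cc /dFn.
    + by apply: cvg_at_right_filter; apply: cFn; rewrite in_itv /= lexx ltW.
    + by apply: cvg_at_left_filter; apply: cFn; rewrite in_itv /= lexx ltW.
  - move=> t /subset_itv_oo_cc /sub /dF dFt.
    by rewrite derive1E derive_val.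
have cv : (fun n => \int[mu]_(t in `[u n, v n]) (f t)%:E)%E @ \oo -->
    (\int[mu]_(t in S) (f t)%:E)%E.
  rewrite SE; apply: ge0_nondecreasing_set_cvg_integral => //.
  - move=> m n mn; rewrite subsetEset => t /=.
    rewrite !in_itv /= => /andP[h1 h2].
    by rewrite (le_trans (ud _ _ mn)) //= (le_trans h2) // vi.
  - by move=> n; apply/measurable_EFinP; exact: subspace_continuous_measurable_fun.
  - by move=> n t /sub /f0; rewrite lee_fin.
rewrite (funext I) in cv.
by apply/esym/(cvg_unique _ _ cv) => //; apply/cvg_EFin => //; exact: nearW.
Qed.

Notation Rpos := (`]0, +oo[%classic : set R).

Lemma is_derive_ratio t : 0 < t ->
  is_derive t 1 (fun t : R => t / (1 + t)) ((1 + t) ^- 2).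
Proof.
move=> t0; have t1 : 1 + t != 0 by rewrite lt0r_neq0 // addr_gt0.
have d1 : is_derive t 1 (fun t : R => 1 + t) 1 by apply: is_derive_eq; ring.
have := is_deriveM (is_derive_id t (1 : R)) (is_deriveV t1 d1).
move=> d; apply: (is_derive_eq d).
by rewrite /GRing.scale /=; field.
Qed.

Lemma cvg_harmonic_shift k : (fun n => (n + k.+1)%:R^-1 : R) @ \oo --> (0 : R).
Proof.
have := @cvg_harmonic R; rewrite -(cvg_shiftn k).
by under eq_fun do rewrite /= -addnS.
Qed.

Lemma cvg_harmonic_powR k c : 0 < c ->
  (fun n => (n + k.+1)%:R^-1 `^ c : R) @ \oo --> (0 : R).
Proof.
move=> c0; apply: (@cvg_comp _ _ _ (fun n => (n + k.+1)%:R^-1) (fun y : R => y `^ c) _ (0^'+)).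
  move=> A A0; have : \forall n \near \oo, 0 < (n + k.+1)%:R^-1 :> R -> A (n + k.+1)%:R^-1.
    exact: (cvg_harmonic_shift k A0).
  apply: filterS => n; apply.
  by rewrite invr_gt0 ltr0n addnS.
exact: powR_cvg0.
Qed.

(** The boundary terms in both uses of ge0_FTC2_bigcup below: t/(1+t) takes the values
    1/(n+3) and 1 - 1/(n+3) at t = 1/(n+2) and t = n+2; in the Beta integral these two
    numbers are the ends of the segments. *)
Lemma cvg_powR_boundary c : 0 < c ->
  (fun n => ((1 - (n + 3)%:R^-1) `^ c - (n + 3)%:R^-1 `^ c) / c : R) @ \oo --> c^-1.
Proof.
move=> c0.
rewrite -[X in _ --> X]mul1r; apply: cvgMl.
rewrite -[X in _ --> X]subr0; apply: cvgB; last exact: cvg_harmonic_powR.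
have h : (fun n => 1 - (n + 3)%:R^-1 : R) @ \oo --> (1 : R).
  by rewrite -[X in _ --> X]subr0; apply: cvgB; [exact: cvg_cst|exact: cvg_harmonic_shift].
have -> : nbhs (1 : R) = nbhs ((1 : R) `^ c) by rewrite powR1.
apply: (cvg_comp _ (fun y : R => y `^ c) h).
have d := is_derive1_powR c (ltr01 : 0 < (1 : R)).
have ct : {for 1, continuous (fun y : R => y `^ c)}.
  exact/differentiable_continuous/derivable1_diffP/(@ex_derive _ _ _ _ _ _ _ d).
exact: ct.
Qed.

(** A primitive is (t/(1+t))^c / c, which increases from 0 to 1/c. *)
Lemma integrable_ratio_powR c : 0 < c ->
  mu.-integrable Rpos (EFin \o (fun t : R => (t / (1 + t)) `^ (c - 1) / (1 + t) ^+ 2)).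
Proof.
move=> c0.
pose f (t : R) := (t / (1 + t)) `^ (c - 1) / (1 + t) ^+ 2.
pose F (t : R) := (t / (1 + t)) `^ c / c.
have f0 t : Rpos t -> 0 <= f t.
  rewrite /= in_itv /= andbT => t0.
  by rewrite divr_ge0 ?powR_ge0 // exprn_ge0 //; lra.
have cf t : Rpos t -> {for t, continuous f}.
  rewrite /= in_itv /= andbT => t0.
  have r0 : 0 < t / (1 + t) by rewrite divr_gt0 // addr_gt0.
  have t1 : 1 + t != 0 by rewrite lt0r_neq0 // addr_gt0.
  have d := @is_derive1_comp R (fun y : R => y `^ (c - 1)) _ t _ _
    (is_derive1_powR (c - 1) r0) (is_derive_ratio t0).
  have d1 : is_derive t 1 (fun t : R => 1 + t) 1 by apply: is_derive_eq; ring.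
  have d2 := is_deriveV t1 d1.
  have -> : f = ((fun y : R => y `^ (c - 1)) \o (fun t : R => t / (1 + t)))
      * (fun t : R => (1 + t)^-1) ^+ 2.
    by apply/funext => z; rewrite /f exprfctE /= -exprVn.
  apply/differentiable_continuous/derivable1_diffP.
  exact: (@ex_derive _ _ _ _ _ _ _ (is_deriveM d (is_deriveX 2 d2))).
have E : (\int[mu]_(t in Rpos) (f t)%:E = (c^-1)%:E)%E.
  (* From n + 2 on, since the segment from 1/(n+1) to n+1 is degenerate for n = 0. *)
  apply: (@ge0_FTC2_bigcup _ F (fun n => n.+2%:R^-1) (fun n => n.+2%:R)) => //.
  - move=> n; rewrite (@lt_le_trans _ _ 1) ?ler1n // invf_lt1 // ltr1n //.
  - by move=> m n mn; rewrite lef_pV2 ?posrE // ler_nat.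
  - by move=> m n mn; rewrite ler_nat.
  - apply/seteqP; split=> t /=.
      rewrite in_itv /= andbT => t0.
      pose n := maxn (Num.truncn t) (Num.truncn t^-1).
      have tn : t < n.+2%:R.
        rewrite (lt_le_trans (truncnS_gt t)) // ler_nat.
        by rewrite ltnS (leq_trans (leq_maxl _ _) (leqnSn _)).
      have tn' : t^-1 < n.+2%:R.
        rewrite (lt_le_trans (truncnS_gt _)) // ler_nat.
        by rewrite ltnS (leq_trans (leq_maxr _ _) (leqnSn _)).
      exists n => //=; rewrite in_itv /= (ltW tn) andbT.
      by rewrite invf_ple ?posrE // ltW.
    by move=> [n _]/=; rewrite !in_itv /= andbT => /andP[+ _]; exact: lt_le_trans.
  - move=> t /=; rewrite in_itv /= andbT => t0.
    have r0 : 0 < t / (1 + t) by rewrite divr_gt0 // addr_gt0.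
    have d := @is_derive1_comp R (fun y : R => y `^ c) _ t _ _
      (is_derive1_powR c r0) (is_derive_ratio t0).
    have {}d := is_deriveZ (c^-1) d.
    have -> : F = c^-1 \*: ((fun y : R => y `^ c) \o (fun t : R => t / (1 + t))).
      by apply/funext => z; rewrite /F /= mulrC.
    apply: (is_derive_eq d).
    by rewrite /GRing.scale /= /f mulrA mulrA mulVf ?mul1r // gt_eqF.
  - have -> : (fun n => F n.+2%:R - F n.+2%:R^-1) =
        (fun n => ((1 - (n + 3)%:R^-1) `^ c - (n + 3)%:R^-1 `^ c) / c).
      apply/funext => n; rewrite /F -mulrBl; congr ((_ `^ _ - _ `^ _) / _).
        rewrite addn3 -[n.+3%:R]nat1r; field.
        by rewrite -!natrD ?nat1r !pnatr_eq0.
      rewrite addn3 -[n.+3%:R]nat1r; field.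
      by rewrite -!natrD ?nat1r !pnatr_eq0.
    exact: cvg_powR_boundary.
apply/integrableP; split.
  apply/measurable_EFinP.
  apply: open_continuous_measurable_fun => //.
  by move=> t /set_mem; exact: cf.
rewrite (_ : (\int[mu]_(t in _) _)%E = (c^-1)%:E) ?ltry // -E.
by apply: eq_integral => t /set_mem ht; rewrite /= ger0_norm // f0.
Qed.

Lemma expR_powR_bounded a c : 0 < a -> 0 < c ->
  exists C : R, forall t, 0 < t -> expR (- (a * t)) * (1 + t) `^ c <= C.
Proof.
move=> a0 c0; exists (expR (a - c * ln (a / c))) => t t0.
have t1 : 0 < 1 + t by rewrite addr_gt0.
rewrite /powR gt_eqF // -expRD ler_expR.
have ac0 : 0 < a / c by rewrite divr_gt0.
have := ln_sublinear (mulr_gt0 ac0 t1).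
rewrite (@lnM _ (a / c)) ?posrE // => /ltW; rewrite -(ler_pM2l c0) mulrDr.
have -> : c * (a / c * (1 + t)) = a * (1 + t) by field; rewrite gt_eqF.
lra.
Qed.

(** Comparison with integrable_ratio_powR: the factor t^(c-1) is matched exactly at 0, and
    expR_powR_bounded absorbs the remaining power (1 + t)^(c+1) at infinity. *)
Lemma integrable_expR_powR a c : 0 < a -> 0 < c ->
  mu.-integrable Rpos (EFin \o (fun t => expR (- (a * t)) * t `^ (c - 1))).
Proof.
move=> a0 c0.
have [C hC] := expR_powR_bounded a0 (addr_gt0 c0 ltr01).
apply: le_integrable (integrableZl _ C (integrable_ratio_powR c0)) => //.
  apply/measurable_EFinP/measurable_funTS/measurable_funM.
    apply: measurableT_comp; first exact: measurable_expR.
    apply: measurableT_comp => //; exact: mulrl_measurable.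
  exact: measurable_powR.
move=> t /=; rewrite in_itv /= andbT => t0.
have t1 : 0 < 1 + t by rewrite addr_gt0.
have C0 : 0 <= C by rewrite (le_trans _ (hC _ t0)) // mulr_ge0 ?expR_ge0 ?powR_ge0.
have g0 : 0 <= (t / (1 + t)) `^ (c - 1) / (1 + t) ^+ 2.
  by rewrite divr_ge0 ?powR_ge0 ?exprn_ge0 ?(ltW t1).
rewrite lee_fin !ger0_norm ?mulr_ge0 ?expR_ge0 ?powR_ge0 ?invr_ge0 ?exprn_ge0 ?(ltW t1) //.
have -> : expR (- (a * t)) * t `^ (c - 1) =
    (expR (- (a * t)) * (1 + t) `^ (c + 1)) * ((t / (1 + t)) `^ (c - 1) / (1 + t) ^+ 2).
  have -> : t `^ (c - 1) = (t / (1 + t)) `^ (c - 1) * (1 + t) `^ (c - 1).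
    by rewrite -powRM ?divfK ?gt_eqF ?divr_ge0 ?(ltW t0) ?(ltW t1).
  have -> : (1 + t) `^ (c + 1) = (1 + t) `^ (c - 1) * (1 + t) ^+ 2.
    rewrite -powR_mulrn ?(ltW t1) // -powRD ?(gt_eqF t1) ?implybT //.
    by congr (_ `^ _); ring.
  by field; rewrite gt_eqF.
by rewrite ler_wpM2r ?hC.
Qed.

Lemma measurable_scale c : measurable_fun [set: measurableTypeR R]
  (( *%R c) : measurableTypeR R -> measurableTypeR R).
Proof. exact: mulrl_measurable. Qed.

(** Both sides are measures, so that it suffices to compare them on intervals. *)
Lemma lebesgue_measure_scale c (A : set R) : 0 < c -> measurable A ->
  (c%:E * pushforward mu (( *%R c) : _ -> measurableTypeR R) A = mu A)%E.
Proof.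
move=> c0 mA.
unshelve epose (nu := mscale (NngNum (ltW c0))
  (pushforward mu ( *%R c : _ -> measurableTypeR R))
  : {measure set (measurableTypeR R) -> \bar R}).
  exact: measurable_scale.
rewrite -[LHS]/(nu A); apply/esym/lebesgue_measure_unique => //= _ [[a b]] _ <-.
have pre : ( *%R c) @^-1` `]a, b]%classic = `]a / c, b / c]%classic.
  by apply/seteqP; split=> t /=; rewrite !in_itv /= ler_pdivlMr // ltr_pdivrMr // mulrC.
change (mu `]a, b]%classic = (c%:E * mu (( *%R c) @^-1` `]a, b]%classic))%E).
rewrite pre.
rewrite !lebesgue_measure_itv /= !lte_fin ltr_pM2r ?invr_gt0 //.
case: ifPn => // _; last by rewrite mule0.
by rewrite -!EFinB -EFinM; congr (_%:E); field; rewrite gt_eqF.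
Qed.

(** The half-line is invariant under scaling, and Lebesgue measure is c times its image
    under t |-> c t. *)
Lemma ge0_integral_scale c (f : R -> \bar R) : 0 < c -> measurable_fun setT f ->
  (forall t, 0 <= f t)%E ->
  (\int[mu]_(t in Rpos) f t = c%:E * \int[mu]_(t in Rpos) f (c * t)%R)%E.
Proof.
move=> c0 mf f0.
have pre : Rpos = ( *%R c : R -> measurableTypeR R) @^-1` Rpos.
  by apply/seteqP; split=> t /=; rewrite !in_itv /= !andbT pmulr_rgt0.
rewrite [in RHS]pre.
rewrite -[X in (_ * X)%E](ge0_integral_pushforward (measurable_scale c)) //; last first.
  exact: measurable_funTS.
have -> : c%:E = (NngNum (ltW c0))%:num%:E by [].
rewrite -ge0_integral_mscale //; last exact: measurable_funTS.
by apply: eq_measure_integral => A mA _; exact/esym/lebesgue_measure_scale.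
Qed.

Lemma Rintegral_scale c f : 0 < c -> measurable_fun setT f ->
  mu.-integrable Rpos (EFin \o f) ->
  mu.-integrable Rpos (EFin \o (fun t => f (c * t))) /\
  Rintegral mu Rpos f = c * Rintegral mu Rpos (fun t => f (c * t)).
Proof.
move=> c0 mf intf.
have mE : measurable_fun setT (EFin \o f) by exact/measurable_EFinP.
have mcf : measurable_fun setT (fun t => f (c * t)).
  by apply: measurableT_comp => //; exact: mulrl_measurable.
have icf : mu.-integrable Rpos (EFin \o (fun t => f (c * t))).
  apply/integrableP; split; first exact/measurable_EFinP/measurable_funTS.
  have /integrableP[_] := intf.
  rewrite (ge0_integral_scale c0) //; last exact/measurableT_comp.
  apply: contraTT; rewrite -!leNgt !leye_eq => /eqP ->.
  by rewrite gt0_muley // lte_fin.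
split=> //.
rewrite /Rintegral -[X in X * _]/(fine c%:E) -fineM //; last exact: integrable_fin_num.
congr fine; rewrite [LHS]integralE [in RHS]integralE muleBr //; last first.
  by rewrite fin_num_adde_defr // integrable_pos_fin_num.
congr (_ - _)%E.
  rewrite (@ge0_integral_scale c (EFin \o f)^\+%E) //; last exact: measurable_funepos.
  by congr (_ * _)%E; apply: eq_integral => t _; rewrite /= !funeposE.
rewrite (@ge0_integral_scale c (EFin \o f)^\-%E) //; last exact: measurable_funeneg.
by congr (_ * _)%E; apply: eq_integral => t _; rewrite /= !funenegE.
Qed.

Lemma Rintegral_sumZ (D : set R) (I : Type) (q : seq I) (c : I -> R) (f : I -> R -> R) :
  measurable (D : set (measurableTypeR R)) ->
  (forall i, mu.-integrable D (EFin \o f i)) ->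
  Rintegral mu D (fun t => \sum_(i <- q) c i * f i t) =
  \sum_(i <- q) c i * Rintegral mu D (f i).
Proof.
move=> mD If.
have Z i : mu.-integrable D (EFin \o (fun t => c i * f i t)).
  exact: (@integrableZl _ _ _ mu D mD (c i) _ (If i)).
elim: q => [|i q IH].
  rewrite big_nil (_ : (fun t => _) = fun=> 0) ?Rintegral_cst ?mul0r //.
  by apply/funext => t; rewrite big_nil.
rewrite big_cons -IH -(RintegralZl _ mD (If i)) -RintegralD //.
  by apply: eq_Rintegral => t _; rewrite big_cons.
have := @integrable_sum _ _ _ mu D mD _ q xpredT _ (fun i _ => Z i).
by apply: eq_integrable => // t _ /=; rewrite sumEFin.
Qed.

(** The integrand is singular at 1 when c < 1. *)
Lemma Rintegral_beta1 c : 0 < c ->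
  mu.-integrable `]0, 1[ (EFin \o (fun t : R => (1 - t) `^ (c - 1))) /\
  Rintegral mu `]0, 1[ (fun t => (1 - t) `^ (c - 1)) = c^-1.
Proof.
move=> c0.
pose f (t : R) := (1 - t) `^ (c - 1).
pose F (t : R) := - ((1 - t) `^ c / c).
have sub t : `]0, 1[%classic t -> 0 < 1 - t by rewrite /= in_itv /= subr_gt0 => /andP[].
have d1 (t : R) : is_derive t 1 (fun t : R => 1 - t) (-1).
  by apply: is_derive_eq; ring.
have dp b (t : R) : 0 < 1 - t ->
    is_derive t 1 (fun t : R => (1 - t) `^ b) (b * (1 - t) `^ (b - 1) * -1).
  move=> t0.
  exact: (@is_derive1_comp R (fun y : R => y `^ b) _ t _ _ (is_derive1_powR b t0) (d1 t)).
have cf t : `]0, 1[%classic t -> {for t, continuous f}.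
  move=> /sub /(dp (c - 1)) /@ex_derive d.
  exact/differentiable_continuous/derivable1_diffP.
have E : (\int[mu]_(t in `]0%R, 1%R[) (f t)%:E = (c^-1)%:E)%E.
  apply: (@ge0_FTC2_bigcup _ F (fun n => (n + 3)%:R^-1) (fun n => 1 - (n + 3)%:R^-1)) => //.
  - move=> n; have : (n + 3)%:R^-1 <= 3^-1 :> R.
      by rewrite lef_pV2 ?posrE ?ltr0n ?addn_gt0 ?orbT // ler_nat leq_addl.
    lra.
  - by move=> m n mn; rewrite lef_pV2 ?posrE ?ltr0n ?addn_gt0 ?orbT // ler_nat leq_add2r.
  - move=> m n mn; rewrite lerD2l lerN2.
    by rewrite lef_pV2 ?posrE ?ltr0n ?addn_gt0 ?orbT // ler_nat leq_add2r.
  - apply/seteqP; split=> t /=.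
      rewrite in_itv /= => /andP[t0 t1].
      have m0 : 0 < Num.min t (1 - t) by rewrite lt_min t0 subr_gt0.
      pose n := Num.truncn (Num.min t (1 - t))^-1.
      have nt : (n + 3)%:R^-1 <= Num.min t (1 - t).
        rewrite invf_ple ?posrE ?ltr0n ?addn_gt0 ?orbT //.
        rewrite (le_trans (ltW (truncnS_gt _))) // ler_nat -/n addn3.
        by rewrite !ltnS (leq_trans (leqnSn _)).
      move: nt; rewrite le_min => /andP[nt nt'].
      by exists n => //=; rewrite in_itv /= nt /=; lra.
    move=> [n _]/=; rewrite !in_itv /= => /andP[h1 h2].
    have h : 0 < (n + 3)%:R^-1 :> R by rewrite invr_gt0 ltr0n addn3.
    by apply/andP; split; lra.
  - by move=> t _; rewrite powR_ge0.
  - move=> t /sub t0.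
    have := is_deriveZ (- c^-1) (dp c _ t0).
    have -> : - c^-1 \*: (fun t : R => (1 - t) `^ c) = F.
      apply/funext => z; rewrite /F /= -[LHS]/(- c^-1 * (1 - z) `^ c); ring.
    move=> d; apply: (is_derive_eq d).
    by rewrite /GRing.scale /= /f; field; rewrite gt_eqF.
  - have -> : (fun n => F (1 - (n + 3)%:R^-1) - F (n + 3)%:R^-1) =
      (fun n => ((1 - (n + 3)%:R^-1) `^ c - (n + 3)%:R^-1 `^ c) / c).
      by apply/funext => n; rewrite /F subKr opprK addrC mulrBl.
    exact: cvg_powR_boundary.
split; last by rewrite /Rintegral E.
apply/integrableP; split.
  apply/measurable_EFinP.
  apply: open_continuous_measurable_fun => //.
  by move=> t /set_mem; exact: cf.
rewrite (_ : (\int[mu]_(t in _) _)%E = (c^-1)%:E) ?ltry // -E.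
by apply: eq_integral => t _; rewrite /= ger0_norm // powR_ge0.
Qed.
End RealIntegrals.

(** * Complex integrals and complex powers *)

Section Complex.
Context {R : realType}.
Notation mu := (@lebesgue_measure R).
Notation Rpos := (`]0, +oo[%classic : set R).
Implicit Types (s z c : R[i]) (f g : R -> R[i]) (A : set R).

Lemma is_sum_complex (F : nat -> R[i]) z (u := fun N => \sum_(1 <= n < N.+1) F n) :
  (fun n => complex.Re (u n)) @ \oo --> complex.Re z ->
  (fun n => complex.Im (u n)) @ \oo --> complex.Im z ->
  is_sum F z.
Proof.
move=> /cvgrPdist_lt hre /cvgrPdist_lt him.
rewrite /is_sum -/u; apply/cvgrPdist_lt => -[e e']; rewrite ltcE /= => /andP[/eqP -> e0].
have e2 : 0 < e / 2 by rewrite divr_gt0.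
near=> n.
have h1 : `|complex.Re z - complex.Re (u n)| < e / 2 by near: n; exact: hre.
have h2 : `|complex.Im z - complex.Im (u n)| < e / 2 by near: n; exact: him.
(* The modulus is at most |Re| + |Im|. *)
rewrite [z - u n]complexE (le_lt_trans (ler_normD _ _)) // normrM.
have -> : `|'i%C : R[i]| = 1 by rewrite normc_def /= expr0n expr1n add0r sqrtr1.
rewrite mul1r.
have nR (x : R) : `|x%:C| = `|x|%:C by rewrite normc_def /= expr0n addr0 sqrtr_sqr.
have -> : complex.Re (z - u n) = complex.Re z - complex.Re (u n) by case: (z); case: (u n).
have -> : complex.Im (z - u n) = complex.Im z - complex.Im (u n) by case: (z); case: (u n).
rewrite !nR -rmorphD ltcR /=; lra.
Unshelve. all: by end_near. Qed.

Lemma Re_addc z c : complex.Re (z + c) = complex.Re z + complex.Re c.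
Proof. by case: z; case: c. Qed.

Lemma Im_addc z c : complex.Im (z + c) = complex.Im z + complex.Im c.
Proof. by case: z; case: c. Qed.

Lemma Re_mulc z c : complex.Re (z * c) =
  complex.Re z * complex.Re c - complex.Im z * complex.Im c.
Proof. by case: z; case: c. Qed.

Lemma Im_mulc z c : complex.Im (z * c) =
  complex.Re z * complex.Im c + complex.Im z * complex.Re c.
Proof. by case: z; case: c. Qed.

Definition cintegrable A f :=
  mu.-integrable A (EFin \o (fun t => complex.Re (f t))) /\
  mu.-integrable A (EFin \o (fun t => complex.Im (f t))).

Lemma eq_cintegral A f g : {in A, f =1 g} -> cintegral A f = cintegral A g.
Proof.
by move=> fg; congr (_ +i* _); apply: eq_Rintegral => t /fg ->.
Qed.

Lemma cintegralZ A c f : measurable A -> cintegrable A f ->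
  cintegral A (fun t => c * f t) = c * cintegral A f.
Proof.
move=> mA [fre fim].
have iZ (r : R) (h : R -> R) : mu.-integrable A (EFin \o h) ->
    mu.-integrable A (EFin \o (fun t => r * h t)).
  by move=> ih; exact: (@integrableZl _ _ _ mu A mA r _ ih).
apply/eqP; rewrite eq_complex Re_mulc Im_mulc /=; apply/andP; split; apply/eqP.
  under eq_Rintegral do rewrite Re_mulc.
  by rewrite RintegralB ?RintegralZl //; exact: iZ.
under eq_Rintegral do rewrite Im_mulc.
by rewrite RintegralD ?RintegralZl //; exact: iZ.
Qed.

Lemma cintegral_scale (a : R) f : 0 < a ->
  measurable_fun setT (fun t => complex.Re (f t)) ->
  measurable_fun setT (fun t => complex.Im (f t)) -> cintegrable Rpos f ->
  cintegrable Rpos (fun t => f (a * t)) /\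
  cintegral Rpos f = a%:C * cintegral Rpos (fun t => f (a * t)).
Proof.
move=> a0 mre mim [fre fim].
have [ire ere] := Rintegral_scale a0 mre fre.
have [iim eim] := Rintegral_scale a0 mim fim.
split; first by split.
rewrite /cintegral ere eim.
by apply/eqP; rewrite eq_complex Re_mulc Im_mulc /= !mul0r subr0 addr0 !eqxx.
Qed.

Lemma Re_cpow z (t : R) :
  complex.Re (cpow t z) = t `^ (complex.Re z) * cos (complex.Im z * ln t).
Proof. by rewrite /cpow Re_mulc /= mul0r subr0. Qed.

Lemma Im_cpow z (t : R) :
  complex.Im (cpow t z) = t `^ (complex.Re z) * sin (complex.Im z * ln t).
Proof. by rewrite /cpow Im_mulc /= mul0r addr0. Qed.

Lemma cpowM (a t : R) z : 0 < a -> 0 < t -> cpow (a * t) z = cpow a z * cpow t z.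
Proof.
move=> a0 t0; rewrite /cpow powRM ?(ltW a0) ?(ltW t0) // lnM ?posrE // mulrDr cosD sinD.
by apply/eqP; rewrite eq_complex !(Re_mulc, Im_mulc) /=; apply/andP; split; apply/eqP; ring.
Qed.

Lemma cpowD (a : R) z c : 0 < a -> cpow a (z + c) = cpow a z * cpow a c.
Proof.
move=> a0; rewrite /cpow Re_addc Im_addc powRD ?(gt_eqF a0) ?implybT // mulrDl cosD sinD.
by apply/eqP; rewrite eq_complex !(Re_mulc, Im_mulc) /=; apply/andP; split; apply/eqP; ring.
Qed.

Lemma cpow_real (a : R) (n : nat) : 0 < a -> cpow a n%:R = (a ^+ n)%:C.
Proof.
move=> a0; rewrite /cpow.
have -> : (n%:R : R[i]) = n%:R%:C by rewrite rmorph_nat.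
by rewrite /= mul0r cos0 sin0 powR_mulrn ?ltW // complexr0 mulr1.
Qed.

Lemma cpowNK (a : R) z : 0 < a -> cpow a (- z) * cpow a z = 1.
Proof. by move=> a0; rewrite -cpowD // addNr -[0]/(0%:R) cpow_real // expr0. Qed.

Lemma cpow_neq0 (a : R) z : 0 < a -> cpow a z != 0.
Proof.
by move=> /(cpowNK z) e; apply: contra_eq_neq e => ->; rewrite mulr0 eq_sym oner_eq0.
Qed.

Lemma cpowN (a : R) z : 0 < a -> cpow a (- z) = (cpow a z)^-1.
Proof.
by move=> a0; apply: (mulIf (cpow_neq0 z a0)); rewrite cpowNK // mulVf ?cpow_neq0.
Qed.

End Complex.

(** * Mellin transforms of exponentially decaying functions *)

Section Mellin.
Context {R : realType}.
Notation mu := (@lebesgue_measure R).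
Notation Rpos := (`]0, +oo[%classic : set R).
Implicit Types (s z c : R[i]) (g k : R -> R) (a b r : R).

(** With a > 0 and Re s > 0 this makes the Mellin transform of g at s converge; the rate a
    is a parameter so that all members of a series share one dominating function. *)
Definition exp_bounded a g := measurable_fun setT g /\
  exists C, forall t, 0 < t -> `|g t| <= C * expR (- (a * t)).

Lemma measurable_expRM b : measurable_fun setT (fun t : R => expR (- (b * t))).
Proof.
apply: measurableT_comp; first exact: measurable_expR.
by apply: measurableT_comp => //; exact: mulrl_measurable.
Qed.

Lemma measurable_horner_expR (q : {poly R}) b :
  measurable_fun setT (fun t : R => q.[expR (- (b * t))]).
Proof.
apply: (@measurableT_comp _ _ _ _ _ _ (horner q)); last exact: measurable_expRM.
by apply: continuous_measurable_fun; exact: continuous_horner.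
Qed.

Lemma exp_bounded_expR a b : a <= b -> exp_bounded a (fun t => expR (- (b * t))).
Proof.
move=> ab; split; first exact: measurable_expRM.
by exists 1 => t t0; rewrite mul1r ger0_norm ?expR_ge0 // ler_expR lerN2 ler_wpM2r // ltW.
Qed.

Lemma exp_boundedZ a (c : R) g : exp_bounded a g -> exp_bounded a (fun t => c * g t).
Proof.
move=> [mg [C hC]]; split; first exact: measurable_funM.
by exists (`|c| * C) => t t0; rewrite normrM -mulrA ler_wpM2l // hC.
Qed.

Lemma exp_boundedD a g k : exp_bounded a g -> exp_bounded a k ->
  exp_bounded a (fun t => g t + k t).
Proof.
move=> [mg [C hC]] [mk [C' hC']]; split; first exact: measurable_funD.
by exists (C + C') => t t0; rewrite (le_trans (ler_normD _ _)) // mulrDl lerD ?hC ?hC'.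
Qed.

Lemma exp_bounded_sum (I : Type) (r : seq I) a (h : I -> R -> R) :
  (forall i, exp_bounded a (h i)) -> exp_bounded a (fun t => \sum_(i <- r) h i t).
Proof.
move=> hb; elim: r => [|i r IH].
  under eq_fun do rewrite big_nil.
  split; first exact: measurable_cst.
  by exists 0 => t _; rewrite normr0 mul0r.
by under eq_fun do rewrite big_cons; exact: exp_boundedD.
Qed.

Lemma exp_bounded_expR_poly a b (q : {poly R}) : 0 <= b ->
  exp_bounded a (fun t => expR (- (a * t)) * q.[expR (- (b * t))]).
Proof.
move=> b0; rewrite (_ : (fun t => _) = fun t =>
    \sum_(i < size q) q`_i * expR (- ((a + b * i%:R) * t))); last first.
  apply/funext => t; rewrite horner_coef mulr_sumr; apply: eq_bigr => i _.
  by rewrite mulrCA -expRM_natl -expRD; congr (_ * expR _); ring.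
apply: exp_bounded_sum => i; apply: exp_boundedZ; apply: exp_bounded_expR.
by rewrite lerDl mulr_ge0.
Qed.

(** Abstracts cos_kernel and sin_kernel below, the real and imaginary parts of t^(s-1),
    so that each real integral is treated once. *)
Definition power_bounded r k := measurable_fun setT k /\
  forall t, 0 < t -> `|k t| <= t `^ (r - 1).

Lemma integrable_exp_power a r g k : 0 < a -> 0 < r ->
  exp_bounded a g -> power_bounded r k ->
  mu.-integrable Rpos (EFin \o (fun t => g t * k t)).
Proof.
move=> a0 r0 [mg [C hC]] [mk hk].
apply: le_integrable (integrableZl _ C (integrable_expR_powR a0 r0)) => //.
  by apply/measurable_EFinP/measurable_funTS/measurable_funM.
move=> t /=; rewrite in_itv /= andbT => t0.
rewrite lee_fin normrM mulrA (le_trans _ (ler_norm _)) //.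
by rewrite ler_pM ?normr_ge0 ?hk ?hC.
Qed.

Lemma Rintegral_dominated_cvg a r (g_ : nat -> R -> R) g k C : 0 < a -> 0 < r ->
  power_bounded r k ->
  (forall n, measurable_fun setT (g_ n)) -> measurable_fun setT g ->
  (forall n t, 0 < t -> `|g_ n t| <= C * expR (- (a * t))) ->
  {ae mu, forall t, Rpos t -> (fun n => g_ n t) @ \oo --> g t} ->
  (fun n => Rintegral mu Rpos (fun t => g_ n t * k t)) @ \oo -->
    Rintegral mu Rpos (fun t => g t * k t).
Proof.
move=> a0 r0 [mk hk] mg_ mg hC cvg.
have mR : measurable (Rpos : set (measurableTypeR R)) by exact: measurable_itv.
have mfn n : measurable_fun Rpos (fun t => (g_ n t * k t)%:E).
  by apply/measurable_EFinP/measurable_funTS/measurable_funM.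
have mf : measurable_fun Rpos (fun t => (g t * k t)%:E).
  by apply/measurable_EFinP/measurable_funTS/measurable_funM.
have ae1 : {ae mu, forall t, Rpos t ->
    (fun n => (g_ n t * k t)%:E) @ \oo --> (g t * k t)%:E}.
  apply: (@filterS _ _ (ae_filter_ringOfSetsType mu)) cvg => t ht /ht h.
  by apply: cvg_EFin; [exact: nearW|apply: cvgMl].
have ig := integrableZl mR C (integrable_expR_powR a0 r0).
have ae2 : {ae mu, forall t n, Rpos t -> (`|(g_ n t * k t)%:E| <=
    C%:E * (EFin \o (fun t => expR (- (a * t)) * t `^ (r - 1))%R) t)%E}.
  apply: aeW => t n /=; rewrite in_itv /= andbT => t0.
  by rewrite lee_fin normrM mulrA ler_pM ?normr_ge0 ?hk ?hC.
have [] := dominated_convergence mR mfn mf ae1 ig ae2.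
move=> ig' _ h; apply: fine_cvg.
rewrite fineK; first exact: h.
exact: integrable_fin_num.
Qed.

(** The Mellin transform of a real function, without a factor 1 / Gamma s. *)
Definition mellin s g : R[i] :=
  cintegral Rpos (fun t => (g t)%:C * cpow t (s - 1)).

Definition cos_kernel s (t : R) := t `^ (complex.Re s - 1) * cos (complex.Im s * ln t).
Definition sin_kernel s (t : R) := t `^ (complex.Re s - 1) * sin (complex.Im s * ln t).

Lemma mellin_integrandE s (u t : R) :
  u%:C * cpow t (s - 1) = u * cos_kernel s t +i* (u * sin_kernel s t).
Proof.
have e : complex.Re (s - 1) = complex.Re s - 1 by case: (s).
have e' : complex.Im (s - 1) = complex.Im s by case: (s) => ? ? /=; rewrite subr0.
apply/eqP; rewrite eq_complex (Re_mulc u%:C) (Im_mulc u%:C) Re_cpow Im_cpow e e' /=.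
by rewrite !mul0r subr0 addr0 !eqxx.
Qed.

Lemma mellinE s g : mellin s g =
  Rintegral mu Rpos (fun t => g t * cos_kernel s t) +i*
  Rintegral mu Rpos (fun t => g t * sin_kernel s t).
Proof.
by rewrite /mellin /cintegral; congr (_ +i* _);
  apply: eq_Rintegral => t _; rewrite mellin_integrandE.
Qed.

Lemma power_bounded_cos s : power_bounded (complex.Re s) (cos_kernel s).
Proof.
split.
  apply: measurable_funM; first exact: measurable_powR.
  apply: (@measurableT_comp _ _ _ _ _ _ (@cos R)).
    by apply: continuous_measurable_fun; exact: continuous_cos.
  by apply: measurable_funM => //; exact: measurable_ln.
move=> t t0; rewrite normrM ger0_norm ?powR_ge0 // ler_piMr ?powR_ge0 //.
by rewrite ler_norml cos_geN1 cos_le1.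
Qed.

Lemma power_bounded_sin s : power_bounded (complex.Re s) (sin_kernel s).
Proof.
split.
  apply: measurable_funM; first exact: measurable_powR.
  apply: (@measurableT_comp _ _ _ _ _ _ (@sin R)).
    by apply: continuous_measurable_fun; exact: continuous_sin.
  by apply: measurable_funM => //; exact: measurable_ln.
move=> t t0; rewrite normrM ger0_norm ?powR_ge0 // ler_piMr ?powR_ge0 //.
by rewrite ler_norml sin_geN1 sin_le1.
Qed.

Lemma eq_mellin s g k : (forall t, 0 < t -> g t = k t) -> mellin s g = mellin s k.
Proof.
move=> gk; apply: eq_cintegral => t; rewrite inE /= in_itv /= andbT => t0.
by rewrite gk.
Qed.

End Mellin.

Section Laplace.
Context {R : realType}.
Notation mu := (@lebesgue_measure R).
Notation Rpos := (`]0, +oo[%classic : set R).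
Variable s : R[i].
Hypothesis s0 : 0 < complex.Re s.
Implicit Types (g k : R -> R) (a b r : R).

Let cosI a g := fun (a0 : 0 < a) gb =>
  @integrable_exp_power R a _ g _ a0 s0 gb (power_bounded_cos s).
Let sinI a g := fun (a0 : 0 < a) gb =>
  @integrable_exp_power R a _ g _ a0 s0 gb (power_bounded_sin s).

Lemma mellin_cintegrable a g : 0 < a -> exp_bounded a g ->
  cintegrable Rpos (fun t => (g t)%:C * cpow t (s - 1)).
Proof.
move=> a0 gb; split.
  by apply: eq_integrable (cosI a0 gb) => // t _; rewrite [in RHS]/comp mellin_integrandE.
by apply: eq_integrable (sinI a0 gb) => // t _; rewrite [in RHS]/comp mellin_integrandE.
Qed.

Lemma mellinZ a r g : 0 < a -> exp_bounded a g ->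
  mellin s (fun t => r * g t) = r%:C * mellin s g.
Proof.
move=> a0 gb; rewrite /mellin -(cintegralZ _ _ (mellin_cintegrable a0 gb)) //.
by apply: eq_cintegral => t _; rewrite rmorphM /= mulrA.
Qed.

Lemma mellinD a g k : 0 < a -> exp_bounded a g -> exp_bounded a k ->
  mellin s (fun t => g t + k t) = mellin s g + mellin s k.
Proof.
move=> a0 gb kb; rewrite !mellinE.
have mR : measurable (Rpos : set (measurableTypeR R)) by exact: measurable_itv.
under eq_Rintegral do rewrite mulrDl.
rewrite (RintegralD mR (cosI a0 gb) (cosI a0 kb)).
under [X in _ +i* X]eq_Rintegral do rewrite mulrDl.
by rewrite (RintegralD mR (sinI a0 gb) (sinI a0 kb)).
Qed.

Lemma mellin_sum (I : Type) (q : seq I) (c : I -> R) (h : I -> R -> R) a : 0 < a ->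
  (forall i, exp_bounded a (h i)) ->
  mellin s (fun t => \sum_(i <- q) c i * h i t) = \sum_(i <- q) (c i)%:C * mellin s (h i).
Proof.
move=> a0 hb; elim: q => [|i q IH].
  rewrite big_nil -(mul0r (mellin s (fun=> 0))) -[0 in RHS]/(0%:C).
  rewrite -(mellinZ (a := a)) //; last first.
    by split; [exact: measurable_cst|exists 0 => t _; rewrite normr0 mul0r].
  by apply: eq_mellin => t _; rewrite big_nil mul0r.
rewrite big_cons -IH -(mellinZ _ a0) // -(mellinD a0).
- by apply: eq_mellin => t _; rewrite big_cons.
- exact: exp_boundedZ.
- by apply: exp_bounded_sum => j; exact: exp_boundedZ.
Qed.

(** Substitute a t for t in the integral of Gamma. *)
Lemma mellin_expR a : 0 < a ->
  mellin s (fun t => expR (- (a * t))) = Gamma s * cpow a (- s).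
Proof.
move=> a0; pose f (t : R) := (expR (- t))%:C * cpow t (s - 1).
have If : cintegrable Rpos f.
  have h : exp_bounded 1 (fun t : R => expR (- t)).
    have := @exp_bounded_expR R 1 1 (lexx _).
    by under eq_fun do rewrite mul1r.
  exact: (mellin_cintegrable ltr01 h).
have me : measurable_fun setT (fun t : R => expR (- t)).
  by have := @measurable_expRM R 1; under eq_fun do rewrite mul1r.
have mre : measurable_fun setT (fun t => complex.Re (f t)).
  rewrite /f; under eq_fun do rewrite mellin_integrandE /=.
  by apply: measurable_funM => //; have [] := power_bounded_cos s.
have mim : measurable_fun setT (fun t => complex.Im (f t)).
  rewrite /f; under eq_fun do rewrite mellin_integrandE /=.
  by apply: measurable_funM => //; have [] := power_bounded_sin s.
have [_ e] := cintegral_scale a0 mre mim If.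
have -> : Gamma s = a%:C * cintegral Rpos (fun t => f (a * t)) by [].
have -> : cintegral Rpos (fun t => f (a * t)) =
    cpow a (s - 1) * mellin s (fun t => expR (- (a * t))).
  rewrite -cintegralZ //; last exact: (mellin_cintegrable a0 (exp_bounded_expR (lexx a))).
  apply: eq_cintegral => t; rewrite inE /= in_itv /= andbT => t0.
  by rewrite /f cpowM // mulrCA.
have -> : a%:C = cpow a 1 by rewrite -[1]/(1%:R) cpow_real.
by rewrite mulrA -cpowD // subrKC mulrAC cpowN // mulfV ?mul1r ?cpow_neq0.
Qed.

(** The two series of the theorem and the nonvanishing of Gamma all rest on this formula, each
    with its own polynomial q. *)
Lemma mellin_expR_poly a b (q : {poly R}) n : 0 < a -> 0 <= b -> (size q <= n)%N ->
  mellin s (fun t => expR (- (a * t)) * q.[expR (- (b * t))])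
  = Gamma s * \sum_(0 <= i < n) (q`_i)%:C * cpow (a + b * i%:R) (- s).
Proof.
move=> a0 b0 qn.
pose h (i : nat) (t : R) := expR (- ((a + b * i%:R) * t)).
have hb i : exp_bounded a (h i) by apply: exp_bounded_expR; rewrite lerDl mulr_ge0.
rewrite (@eq_mellin R s _ (fun t => \sum_(0 <= i < n) q`_i * h i t)); last first.
  move=> t t0; rewrite (horner_coef_wide _ qn) mulr_sumr big_mkord.
  apply: eq_bigr => i _; rewrite mulrCA /h -expRM_natl -expRD; congr (_ * expR _).
  by ring.
rewrite (mellin_sum _ _ a0 hb) mulr_sumr; apply: eq_bigr => i _.
by rewrite /h mellin_expR 1?mulrCA // ltr_wpDr // mulr_ge0.
Qed.

Lemma Re_mellin_cvg (g_ : nat -> R -> R) g a C : 0 < a ->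
  (forall n, measurable_fun setT (g_ n)) -> measurable_fun setT g ->
  (forall n t, 0 < t -> `|g_ n t| <= C * expR (- (a * t))) ->
  {ae mu, forall t, Rpos t -> (fun n => g_ n t) @ \oo --> g t} ->
  (fun n => complex.Re (mellin s (g_ n))) @ \oo --> complex.Re (mellin s g).
Proof.
move=> a0 mg_ mg hC cvg; rewrite mellinE; under eq_fun do rewrite mellinE.
exact: (Rintegral_dominated_cvg a0 s0 (power_bounded_cos s) mg_ mg hC cvg).
Qed.

(** Termwise integration under a bound on the partial sums: the terms themselves need not
    be absolutely summable. *)
Lemma is_sum_mellin (F : nat -> R[i]) (g_ : nat -> R -> R) g a C : 0 < a ->
  (forall N, measurable_fun setT (g_ N)) -> measurable_fun setT g ->
  (forall N t, 0 < t -> `|g_ N t| <= C * expR (- (a * t))) ->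
  (forall t, 0 < t -> (fun N => g_ N t) @ \oo --> g t) ->
  (forall N, \sum_(1 <= n < N.+1) F n = (Gamma s)^-1 * mellin s (g_ N)) ->
  is_sum F ((Gamma s)^-1 * mellin s g).
Proof.
move=> a0 mg_ mg hC cvg FE.
have ae : {ae mu, forall t, Rpos t -> (fun n => g_ n t) @ \oo --> g t}.
  by apply: aeW => t /=; rewrite in_itv /= andbT => /cvg.
have cre := Rintegral_dominated_cvg a0 s0 (power_bounded_cos s) mg_ mg hC ae.
have cim := Rintegral_dominated_cvg a0 s0 (power_bounded_sin s) mg_ mg hC ae.
apply: is_sum_complex.
  rewrite mellinE Re_mulc.
  rewrite (_ : (fun n => _) = fun n => complex.Re (Gamma s)^-1 *
      Rintegral mu Rpos (fun t => g_ n t * cos_kernel s t) - complex.Im (Gamma s)^-1 *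
      Rintegral mu Rpos (fun t => g_ n t * sin_kernel s t)); last first.
    by apply/funext => n; rewrite FE mellinE Re_mulc.
  by apply: cvgB; apply: cvgMr.
rewrite mellinE Im_mulc.
rewrite (_ : (fun n => _) = fun n => complex.Re (Gamma s)^-1 *
    Rintegral mu Rpos (fun t => g_ n t * sin_kernel s t) + complex.Im (Gamma s)^-1 *
    Rintegral mu Rpos (fun t => g_ n t * cos_kernel s t)); last first.
  by apply/funext => n; rewrite FE mellinE Im_mulc.
by apply: cvgD; apply: cvgMr.
Qed.

End Laplace.

(** * The Gamma function has no zero with positive real part *)

Section GammaNeq0.
Context {R : realType}.
Notation mu := (@lebesgue_measure R).
Notation Rpos := (`]0, +oo[%classic : set R).
Implicit Types (u y t c : R) (s : R[i]).

Lemma onem_expr_ge y m : 0 <= y <= 1 -> 1 - m%:R * y <= (1 - y) ^+ m.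
Proof.
move=> /andP[y0 y1]; elim: m => [|m IH]; first by rewrite mul0r subr0 expr0.
rewrite exprS (le_trans _ (ler_wpM2l _ IH)) ?subr_ge0 // -natr1.
have : 0 <= m%:R * (y * y) by rewrite !mulr_ge0.
lra.
Qed.

Lemma onem_expr_le y m : 0 <= y <= 1 -> (1 - y) ^+ m * (1 + m%:R * y) <= 1.
Proof.
move=> /andP[y0 y1]; elim: m => [|m IH]; first by rewrite mul0r addr0 expr0 mul1r.
rewrite (le_trans _ IH) // exprSr -mulrA ler_wpM2l ?exprn_ge0 ?subr_ge0 // -natr1.
have : 0 <= (m%:R + 1) * (y * y) by rewrite !mulr_ge0 // addr_ge0.
lra.
Qed.

(** These polynomials approximate a step at 1/2, as in proofs of Weierstrass' theorem: the
    power behaves like exp(-(2 u)^n), and onem_expr_ge and onem_expr_le make this precise. *)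
Lemma step_poly_cvg u : 0 <= u <= 1 -> u != 2^-1 ->
  (fun n => (1 - u ^+ n) ^+ (2 ^ n)) @ \oo --> ((u < 2^-1)%R%:R : R).
Proof.
move=> /andP[u0 u1] u2.
have un n : 0 <= u ^+ n <= 1 by rewrite exprn_ge0 // exprn_ile1.
have e n : (2 ^ n)%:R * u ^+ n = (2 * u) ^+ n by rewrite natrX exprMn.
case: ltP => [ul|ug].
  have h : (fun n => 1 - (2 * u) ^+ n) @ \oo --> (1 : R).
    rewrite -[X in _ --> X]subr0; apply: cvgB; first exact: cvg_cst.
    by apply: cvg_expr; rewrite ger0_norm ?mulr_ge0 //; lra.
  apply: (squeeze_cvgr _ h (cvg_cst (1 : R))).
  apply: nearW => n; rewrite -e onem_expr_ge //=.
  by have /andP[? ?] := un n; rewrite exprn_ile1 // ?subr_ge0 // lerBlDr lerDl.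
have {ug u2} ug : 2^-1 < u by rewrite lt_neqAle eq_sym u2.
have h : (fun n => ((2 * u)^-1) ^+ n) @ \oo --> (0 : R).
  apply: cvg_expr; rewrite ger0_norm ?invr_ge0 ?mulr_ge0 // invf_lt1; lra.
apply: (squeeze_cvgr _ (cvg_cst (0 : R)) h).
apply: nearW => n; have /andP[h0 h1] := un n.
rewrite exprn_ge0 ?subr_ge0 //= exprVn.
have p0 : 0 < (2 * u) ^+ n by rewrite exprn_gt0 // mulr_gt0 //; lra.
rewrite -[leRHS]mul1r ler_pdivlMr // (le_trans _ (onem_expr_le (2 ^ n) (un n))) //.
by rewrite e ler_wpM2l ?exprn_ge0 ?subr_ge0 // lerDr.
Qed.

(** By mellin_expR_poly the integrals of exp(-t) q(exp(-b t)) t^(s-1) all vanish; let q run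
    through the polynomials of step_poly_cvg, with b such that exp(-b c) = 1/2. *)
Lemma mellin_step_eq0 s c : 0 < complex.Re s -> Gamma s = 0 -> 0 < c ->
  complex.Re (mellin s (fun t => expR (- t) * \1_(`]c, +oo[) t)) = 0.
Proof.
move=> s0 G0 c0.
pose b := ln 2 / c.
have ln2 : 0 < ln (2 : R) by rewrite ln_gt0 // ltr1n.
have b0 : 0 < b by rewrite divr_gt0.
pose q n : {poly R} := (1 - 'X^n) ^+ (2 ^ n).
pose g_ n t := expR (- (1 * t)) * (q n).[expR (- (b * t))].
have qE n z : (q n).[z] = (1 - z ^+ n) ^+ (2 ^ n).
  by rewrite /q !hornerE.
have G n : mellin s (g_ n) = 0.
  by rewrite /g_ (mellin_expR_poly s0 ltr01 (ltW b0) (leqnn _)) G0 mul0r.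
have u01 t : 0 < t -> 0 <= expR (- (b * t)) <= 1.
  move=> t0; rewrite expR_ge0 -[leRHS]expR0 ler_expR oppr_le0.
  by rewrite mulr_ge0 // ltW.
have mg n : measurable_fun setT (g_ n).
  by apply: measurable_funM; [exact: measurable_expRM|exact: measurable_horner_expR].
have mg' : measurable_fun setT (fun t => expR (- (1 * t)) * \1_(`]c, +oo[) t).
  apply: measurable_funM; first exact: measurable_expRM.
  by apply/measurable_indicP; exact: measurable_itv.
have le1 n t : 0 < t -> `|g_ n t| <= 1 * expR (- (1 * t)).
  move=> /u01 /andP[h0 h1]; rewrite /g_ qE mulrC normrM.
  rewrite (ger0_norm (expR_ge0 _)) ler_wpM2r ?expR_ge0 //.
  by rewrite normrX exprn_ile1 // ger0_norm ?subr_ge0 ?exprn_ile1 // gerBl exprn_ge0.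
have ae : {ae mu, forall t, Rpos t -> (fun n => g_ n t) @ \oo -->
    expR (- (1 * t)) * \1_(`]c, +oo[) t}.
  (* At t = c, where exp(-b t) = 1/2, the polynomials tend to 1/e instead. *)
  exists [set c]; split; [exact: measurable_set1|exact: lebesgue_measure_set1|].
  move=> t /=; apply: contra_notP => tc; rewrite in_itv /= andbT => t0.
  rewrite /g_; apply: cvgMr.
  under eq_fun do rewrite qE.
  have half : 2^-1 = expR (- (b * c)).
    by rewrite /b divfK ?gt_eqF // expRN lnK ?posrE.
  have -> : \1_(`]c, +oo[) t = (expR (- (b * t)) < 2^-1)%R%:R :> R.
    by rewrite indicE half ltr_expR ltrN2 ltr_pM2l // mem_setE in_itv /= andbT.
  apply: step_poly_cvg; first exact: u01.
  rewrite half (inj_eq (@expR_inj _)) eqr_opp (inj_eq (mulfI (lt0r_neq0 b0))).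
  exact/eqP.
have cv := Re_mellin_cvg s0 ltr01 mg mg' le1 ae.
have e : mellin s (fun t => expR (- t) * \1_(`]c, +oo[) t) =
    mellin s (fun t => expR (- (1 * t)) * \1_(`]c, +oo[) t).
  by apply: eq_mellin => t _; rewrite mul1r.
have cz : (fun n => complex.Re (mellin s (g_ n))) @ \oo --> (0 : R).
  rewrite (_ : (fun n => complex.Re (mellin s (g_ n))) = cst 0); first exact: cvg_cst.
  by apply/funext => n; rewrite G.
rewrite e; exact: (@cvg_unique _ (@Rhausdorff R) _ _ _ _ cv cz).
Qed.

(** If Gamma vanished at s, so would, by mellin_step_eq0, the real part of the integral of
    exp(-t) t^(s-1) over ]1, d]. But cos (Im s * ln t) is positive there if d is close to 1. *)
Lemma Gamma_neq0 s : 0 < complex.Re s -> Gamma s != 0.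
Proof.
move=> s0; apply/negP => /eqP G0.
pose v := (`|complex.Im s| + 1)^-1.
have v0 : 0 < v by rewrite invr_gt0 ltr_wpDl.
(* With this choice |Im s * ln t| < 1 < pi / 2 on ]1, d]. *)
pose d := expR v.
have d1 : 1 < d by rewrite -expR0 ltr_expR.
pose g t : R := expR (- t) * \1_(`]1, d]) t.
have gE t : g t = expR (- t) * \1_(`]1, +oo[) t + -1 * (expR (- t) * \1_(`]d, +oo[) t).
  rewrite /g !indicE !mem_setE !in_itv /= !andbT.
  by have [td|td] := leP t d; have [t1|t1] := ltP 1 t; rewrite /=; lra.
have eb c : exp_bounded 1 (fun t => expR (- t) * \1_(`]c, +oo[) t).
  split.
    apply: measurable_funM; last by apply/measurable_indicP; exact: measurable_itv.
    by have := @measurable_expRM R 1; under eq_fun do rewrite mul1r.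
  exists 1 => t _; rewrite !mul1r normrM ger0_norm ?expR_ge0 // ler_piMr ?expR_ge0 //.
  by rewrite indicE ger0_norm // lern1 leq_b1.
have Rg : complex.Re (mellin s g) = 0.
  have -> : mellin s g = mellin s (fun t => expR (- t) * \1_(`]1, +oo[) t) +
      (-1)%:C * mellin s (fun t => expR (- t) * \1_(`]d, +oo[) t).
    rewrite -(mellinZ s0 _ ltr01) // -(mellinD s0 ltr01) //; last exact: exp_boundedZ.
    by apply: eq_mellin => t _; rewrite gE.
  rewrite Re_addc Re_mulc !mellin_step_eq0 ?expR_gt0 //=.
  by rewrite mul0r mulr0 subr0 addr0.
have gk1 t : 1 < t <= d -> 0 < g t * cos_kernel s t.
  move=> /andP[t1 td]; have t0 : 0 < t := lt_trans ltr01 t1.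
  rewrite /g indicE mem_setE in_itv /= t1 td mulr1 mulr_gt0 ?expR_gt0 //.
  rewrite mulr_gt0 ?powR_gt0 // cos_gt0_pihalf //.
  have pi1 := @pihalf_ge1 R.
  have lt0 : 0 <= ln t by rewrite ln_ge0 // ltW.
  have ltv : ln t <= v by rewrite -[leRHS]expRK ler_ln ?posrE ?expR_gt0.
  have h : `|complex.Im s * ln t| < 1.
    rewrite normrM (ger0_norm lt0) (le_lt_trans (ler_wpM2l (normr_ge0 _) ltv)) //.
    by rewrite /v ltr_pdivrMr ?ltr_wpDl // mul1r ltrDl.
  by move: h; rewrite ltr_norml => /andP[h1 h2]; apply/andP; split; lra.
have gk t : 0 <= g t * cos_kernel s t.
  have [/gk1 /ltW //|/negPf h] := boolP (1 < t <= d).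
  by rewrite /g indicE mem_setE in_itv /= h mulr0 mul0r.
have ebg : exp_bounded 1 g.
  rewrite (_ : g = fun t => expR (- t) * \1_(`]1, +oo[) t +
      -1 * (expR (- t) * \1_(`]d, +oo[) t)); last exact/funext.
  by apply: exp_boundedD => //; exact: exp_boundedZ.
have Ig := integrable_exp_power ltr01 s0 ebg (power_bounded_cos s).
have I0 : (\int[mu]_(t in Rpos) `| (g t * cos_kernel s t)%:E | = 0)%E.
  transitivity (\int[mu]_(t in Rpos) (g t * cos_kernel s t)%:E)%E.
    by apply: eq_integral => t _; rewrite gee0_abs // lee_fin.
  have := Rg; rewrite mellinE /= /Rintegral => /eqP.
  by rewrite fine_eq0 => [/eqP //|]; exact: integrable_fin_num.
have mI : measurable_fun Rpos (EFin \o (fun t => g t * cos_kernel s t)).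
  exact: (measurable_int mu).
have mR : measurable (Rpos : set (measurableTypeR R)) by exact: measurable_itv.
have [N [mN N0 sN]] := (@ae_eq_integral_abs _ _ _ mu _ mR _ mI).1 I0.
have : (mu `]1%R, d]%classic <= mu N)%E.
  have mI1 : measurable (`]1, d]%classic : set (measurableTypeR R)) by exact: measurable_itv.
  apply: le_measure; rewrite ?inE //.
  move=> t /=; rewrite in_itv /= => t1d; apply: sN => /= h.
  have t0 : `]0, +oo[%classic t.
    by rewrite /= in_itv /= andbT; move/andP: t1d => [+ _]; exact: lt_trans.
  by have := gk1 _ t1d; have /= [->] := h t0; rewrite ltxx.
rewrite N0 lebesgue_measure_itv /= lte_fin d1 -EFinB lee_fin; lra.
Qed.
End GammaNeq0.

(** * The two series *)

Section TwoSeries.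
Context {R : realType}.
Notation mu := (@lebesgue_measure R).
Notation Rpos := (`]0, +oo[%classic : set R).
Implicit Types (t w : R).

Lemma eq_is_sum (K : numFieldType) (F G : nat -> K) (l : K) :
  (forall n, F n.+1 = G n.+1) -> is_sum F l -> is_sum G l.
Proof.
move=> FG; rewrite /is_sum.
suff -> : (fun N => \sum_(1 <= n < N.+1) G n) = (fun N => \sum_(1 <= n < N.+1) F n) by [].
by apply/funext => N; apply: eq_big_nat => -[|n].
Qed.

Variables (p x : R) (s : R[i]).
Hypotheses (hp : 2 <= p) (hx : 0 < x + 1) (hs : 0 < complex.Re s).
Let a := x + 1.

Lemma expRN_itv t : 0 < t -> 0 < expR (- t) < 1.
Proof. by move=> t0; rewrite expR_gt0 -[ltRHS]expR0 ltr_expR oppr_lt0. Qed.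

Lemma powR_expR_factor n t : 0 < t ->
  (1 - expR (- t)) `^ n.+1%:R / (expR t - 1) * expR (- (x * t)) =
  expR (- (a * t)) * ((1 - 'X) ^+ n : {poly R}).[expR (- (1 * t))].
Proof.
move=> /expRN_itv /andP[w0 w1]; rewrite powR_mulrn ?subr_ge0 ?ltW // mul1r.
have -> : expR (- (a * t)) = expR (- (x * t)) * expR (- t).
  by rewrite -expRD; congr expR; rewrite /a; ring.
have -> : expR t = (expR (- t))^-1 by rewrite expRN invrK.
rewrite horner_exp !hornerE exprS; field.
by rewrite mulN1r !gt_eqF ?subr_gt0.
Qed.

Lemma D_lambdaE n : D (lambda s x) n.+1%:R = (Gamma s)^-1 *
  mellin s (fun t => expR (- (a * t)) * ((1 - 'X) ^+ n : {poly R}).[expR (- (1 * t))]).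
Proof.
rewrite /mellin -cintegralZ //; last first.
  exact: (mellin_cintegrable hs hx (exp_bounded_expR_poly a _ ler01)).
apply: eq_cintegral => t; rewrite inE /= in_itv /= andbT => t0.
by rewrite -powR_expR_factor // [in RHS]rmorphM /= /lambda; ring.
Qed.

(** For t > 0 this is exp(-x t) / (exp t - 1), written so that the decay exp(-a t) shows. *)
Let base t := expR (- (a * t)) * (1 - expR (- t)) `^ (-1).
(** The integrand of Z1, with Li1 (z) written as - ln (1 - z). *)
Let G t := base t * - ln (1 - (1 - expR (- t)) / p).

Let baseE t : 0 < t -> base t = expR (- (a * t)) / (1 - expR (- t)).
Proof.
move=> /expRN_itv /andP[_ w1].
by rewrite /base powR_inv1 ?subr_ge0 ?ltW.
Qed.

Let measurable_expRN : measurable_fun setT (fun t => expR (- t)).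
Proof. by have := @measurable_expRM R 1; under eq_fun do rewrite mul1r. Qed.

Let measurable_base : measurable_fun setT base.
Proof.
apply: measurable_funM; first exact: measurable_expRM.
apply: (@measurableT_comp _ _ _ _ _ _ (fun y : R => y `^ (-1))); first exact: measurable_powR.
exact: measurable_funB.
Qed.

Let measurable_G : measurable_fun setT G.
Proof.
apply: measurable_funM => //; apply: measurable_funN.
apply: (@measurableT_comp _ _ _ _ _ _ (@ln R)); first exact: measurable_ln.
apply: measurable_funB => //; apply: measurable_funM => //.
exact: measurable_funB.
Qed.

Lemma onem_div_itv w : 0 < w < 1 -> 0 <= (1 - w) / p <= 2^-1.
Proof.
move=> /andP[w0 w1]; have h := hp; have p0 : 0 < p by lra.
rewrite ler_pdivrMr // divr_ge0 ?(ltW p0) ?subr_ge0 ?(ltW w1) //=; lra.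
Qed.

Lemma Z1E : Z1 p s x = (Gamma s)^-1 * mellin s G.
Proof.
rewrite /Z1; congr (_ * _); apply: eq_mellin => t t0.
have /andP[w0 w1] := expRN_itv t0.
rewrite Li1E; last first.
  by have /andP[h1 ->] := onem_div_itv (expRN_itv t0); rewrite (le_trans _ h1) ?lerN10.
congr (_ * _); rewrite baseE //.
have -> : expR (- (a * t)) = expR (- (x * t)) * expR (- t).
  by rewrite -expRD; congr expR; rewrite /a; ring.
have -> : expR t = (expR (- t))^-1 by rewrite expRN invrK.
by field; rewrite ?mulN1r !gt_eqF ?subr_gt0.
Qed.

(** The partial sums of both series are differences of values of log_poly; being 2-Lipschitz
    it makes them at most a multiple of 1 - exp(-t), which cancels the pole of base at 0. *)
Let base_le t (c : R) : 0 < t -> `|c| <= 2 * (1 - expR (- t)) ->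
  `|base t * c| <= 2 * expR (- (a * t)).
Proof.
move=> t0 hc; have /andP[w0 w1] := expRN_itv t0.
have w1' : 0 < 1 - expR (- t) by rewrite subr_gt0.
rewrite baseE // normrM ger0_norm ?divr_ge0 ?expR_ge0 ?(ltW w1') //.
rewrite mulrAC ler_pdivrMr //.
by rewrite -mulrA mulrCA ler_wpM2l ?expR_ge0.
Qed.

(** The partial sums of Li1 at (1 - exp(-t)) / p, integrated termwise. *)
Lemma is_sum_D : is_sum (fun n => D (lambda s x) n%:R / (n%:R * p%:C ^+ n)) (Z1 p s x).
Proof.
have hp2 := hp; have p0 : 0 < p by lra.
rewrite Z1E.
pose z t := (1 - expR (- t)) / p.
have hz t : 0 < t -> 0 <= z t <= 2^-1 by move=> /expRN_itv; exact: onem_div_itv.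
pose g_ N t := base t * (log_poly N).[z t].
apply: (@is_sum_mellin _ s hs _ g_ _ a 2 hx) => //.
- move=> N; apply: measurable_funM => //.
  apply: (@measurableT_comp _ _ _ _ _ _ (horner (log_poly N))).
    by apply: continuous_measurable_fun; exact: continuous_horner.
  by apply: measurable_funM => //; exact: measurable_funB.
- move=> N t t0; apply: base_le => //.
  have /andP[h1 h2] := hz _ t0.
  have := @log_poly_lipschitz R N (z t) 0.
  rewrite log_poly0 !subr0 => /(_ _ _)/le_trans; apply.
  + by rewrite h2 andbT (le_trans _ h1) ?lerN10.
  + by apply/andP; split; lra.
  have /andP[w0 w1] := expRN_itv t0.
  by rewrite ler_wpM2l // ger0_norm // /z ler_pdivrMr // ler_peMr; lra.
- move=> t t0; apply: cvgMr; apply: log_poly_cvg.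
  by have /andP[h1 ->] := hz _ t0; rewrite (le_trans _ h1) ?lerN10.
move=> N.
pose h n t := expR (- (a * t)) * ((1 - 'X) ^+ n.-1 : {poly R}).[expR (- (1 * t))].
transitivity ((Gamma s)^-1 * \sum_(1 <= n < N.+1) ((n%:R * p ^+ n)^-1)%:C * mellin s (h n)).
  rewrite mulr_sumr; apply: eq_big_nat => -[//|n] _.
  rewrite D_lambdaE -mulrA; congr (_ * _); rewrite mulrC; congr (_ * _).
  by rewrite fmorphV rmorphM rmorphXn rmorph_nat.
rewrite -(mellin_sum hs _ _ hx) => [|n]; last exact: exp_bounded_expR_poly.
congr (_ * _); apply: eq_mellin => t t0.
rewrite /g_ baseE // horner_log_poly mulr_sumr.
apply: eq_big_nat => -[//|n] _.
have /andP[w0 w1] := expRN_itv t0.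
rewrite /h /=.
have -> : ((1 - 'X) ^+ n : {poly R}).[expR (- (1 * t))] = (1 - expR (- t)) ^+ n.
  by rewrite mul1r horner_exp !hornerE.
rewrite /z exprMn exprVn !exprS; field.
by rewrite nat1r pnatr_eq0 expf_neq0 !gt_eqF ?subr_gt0.
Qed.

Let geom n : {poly R} := \poly_(i < n) 1.

Let geomE n w : w < 1 -> (geom n).[w] = (1 - w ^+ n) / (1 - w).
Proof.
move=> w1; have w1' : 1 - w != 0 by rewrite gt_eqF ?subr_gt0.
apply: (mulIf w1'); rewrite divfK // /geom horner_poly.
rewrite -[RHS]opprB subrX1 mulrC -mulNr opprB; congr (_ * _).
by apply: eq_bigr => i _; rewrite mul1r.
Qed.

(** The exponentials exp(-(j + x) t) for j = 1, ..., n form a geometric progression. *)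
Lemma H_mellin n : H n s x = (Gamma s)^-1 *
  mellin s (fun t => expR (- (a * t)) * (geom n).[expR (- (1 * t))]).
Proof.
rewrite (mellin_expR_poly hs hx ler01 (size_poly _ _)) mulKf ?Gamma_neq0 //.
rewrite /H big_add1 /=; apply: eq_big_nat => i /andP[_ ni].
rewrite coef_poly ni mul1r; congr (cpow _ _).
by rewrite mul1r -natr1 /a; ring.
Qed.

(** With w = exp(-t) and q = p - 1, the geometric sum gives 1 - w^n under the integral, and
    the sum of (-1)^(n+1) (1 - w^n) / (n q^n) is ln (1 + 1/q) - ln (1 + w/q), which is
    - ln (1 - (1 - w)/p). For q = 1 the point -1/q is the endpoint of the series. *)
Lemma is_sum_H :
  is_sum (fun n => (-1) ^+ n.+1 * H n s x / (n%:R * (p - 1)%:C ^+ n)) (Z1 p s x).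
Proof.
have hp2 := hp; have p0 : 0 < p by lra.
pose q := p - 1; have q1 : 1 <= q by rewrite /q; lra.
have q0 : 0 < q by rewrite (lt_le_trans _ q1).
have hv u : 0 < u <= 1 -> -1 <= - (u / q) <= 2^-1.
  move=> /andP[u0 u1]; apply/andP; split.
    by rewrite lerN2 ler_pdivrMr // mul1r (le_trans u1).
  rewrite (@le_trans _ _ 0) ?invr_ge0 // oppr_le0 divr_ge0 // ltW //.
rewrite Z1E.
pose v t := - (expR (- t) / q).
have hvt t : 0 < t -> -1 <= v t <= 2^-1.
  by move=> /expRN_itv /andP[w0 w1]; apply: hv; rewrite w0 ltW.
have hv1 : -1 <= - (1 / q) <= 2^-1 by apply: hv; rewrite ltr01 lexx.
pose g_ N t := base t * ((log_poly N).[v t] - (log_poly N).[- (1 / q)]).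
apply: (@is_sum_mellin _ s hs _ g_ _ a 2 hx) => //.
- move=> N; apply: measurable_funM => //; apply: measurable_funB => //.
  apply: (@measurableT_comp _ _ _ _ _ _ (horner (log_poly N))).
    by apply: continuous_measurable_fun; exact: continuous_horner.
  by apply: measurable_funN; exact: measurable_funM.
- move=> N t t0; apply: base_le => //.
  rewrite (le_trans (log_poly_lipschitz N (hvt _ t0) hv1)) // ler_wpM2l //.
  have /andP[w0 w1] := expRN_itv t0.
  rewrite /v opprK -mulNr -mulrDl addrC ger0_norm; last first.
    by rewrite divr_ge0 ?(ltW q0) // subr_ge0 ltW.
  by rewrite ler_pdivrMr // ler_peMr // subr_ge0 ltW.
- move=> t t0; have /andP[w0 w1] := expRN_itv t0.
  rewrite /G; apply: cvgMr.
  have -> : - ln (1 - (1 - expR (- t)) / p) = - ln (1 - v t) - - ln (1 - - (1 / q)).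
    have wq : 0 < expR (- t) / q by rewrite divr_gt0.
    have q1' : 0 < 1 / q by rewrite divr_gt0.
    have /onem_div_itv/andP[z0 z1] := expRN_itv t0.
    rewrite [- - ln _]opprK [RHS]addrC -ln_div ?posrE; last 2 first.
    + by rewrite opprK addr_gt0.
    + by rewrite /v opprK addr_gt0.
    rewrite -lnV ?posrE; last by rewrite subr_gt0 (le_lt_trans z1) // invf_lt1 // ltr1n.
    congr ln; rewrite /v /q; field.
    by rewrite -/q opprK !gt_eqF // addr_gt0.
  exact: (cvgB (log_poly_cvg (hvt _ t0)) (log_poly_cvg hv1)).
move=> N.
pose h n t := expR (- (a * t)) * (geom n).[expR (- (1 * t))].
transitivity ((Gamma s)^-1 * \sum_(1 <= n < N.+1)
    ((-1) ^+ n.+1 / (n%:R * q ^+ n))%:C * mellin s (h n)).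
  rewrite mulr_sumr; apply: eq_big_nat => -[//|n] _.
  have -> : ((-1) ^+ n.+2 / (n.+1%:R * q ^+ n.+1))%:C =
      (-1) ^+ n.+2 / (n.+1%:R * (p - 1)%:C ^+ n.+1) :> R[i].
    have rM (u u' : R) : (u * u')%:C = u%:C * u'%:C by exact: rmorphM.
    have rD (u u' : R) : (u / u')%:C = u%:C / u'%:C by exact: fmorph_div.
    by rewrite rD (rM n.+1%:R) !rmorphXn rmorphN1 rmorph_nat.
  by rewrite H_mellin /h; ring.
rewrite -(mellin_sum hs _ _ hx) => [|n]; last exact: exp_bounded_expR_poly.
congr (_ * _); apply: eq_mellin => t t0.
have /andP[w0 w1] := expRN_itv t0.
rewrite /g_ baseE // !horner_log_poly -sumrB mulr_sumr.
apply: eq_big_nat => -[//|n] _.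
rewrite /h mul1r geomE // /v !(exprNn (_ / q)) !exprMn expr1n exprVn !(exprS (-1)).
by field; rewrite nat1r pnatr_eq0 expf_neq0 /= ?(gt_eqF q0) // gt_eqF ?subr_gt0.
Qed.

Lemma complex_shift_neq0 k : a%:C + k%:R != 0 :> R[i].
Proof.
by rewrite -[k%:R](rmorph_nat (real_complex R)) -rmorphD fmorph_eq0 gt_eqF // ltr_wpDr.
Qed.

Lemma coef_onem_complex n k :
  (((1 - 'X) ^+ n : {poly R})`_k)%:C = ((1 - 'X) ^+ n : {poly R[i]})`_k.
Proof. by rewrite !coef_1subXn rmorphM rmorphXn rmorphN1 rmorph_nat. Qed.

Lemma cpowNn (b : R) k : 0 < b -> cpow b (- k%:R) = b%:C ^- k.
Proof. by move=> b0; rewrite cpowN // cpow_real // rmorphXn. Qed.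

Lemma D_lambda_diff_pow n m : s = m%:R + 1 ->
  D (lambda s x) n.+1%:R = diff_pow n m.+1 (a%:C).
Proof.
move=> sE; rewrite D_lambdaE (mellin_expR_poly (n := n.+1) hs hx ler01); last first.
  exact: size_1subXn.
rewrite mulKf ?Gamma_neq0 // big_mkord; apply: eq_bigr => k _.
have ak : 0 < a + 1 * k%:R by rewrite mul1r; apply: ltr_wpDr.
rewrite coef_onem_complex sE natr1 (cpowNn m.+1 ak); congr (_ * _ ^- _).
by rewrite mul1r rmorphD rmorph_nat.
Qed.

(** Expand t^n in powers of 1 - t and integrate each term. *)
Lemma Beta_diff_pow n : (Beta n.+1%:R (1 + x))%:C = diff_pow n 1 (a%:C).
Proof.
have ak k : 0 < a + k%:R by rewrite ltr_wpDr.
pose f k t := (1 - t) `^ (a + k%:R - 1).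
have -> : Beta n.+1%:R (1 + x) =
    \sum_(k < n.+1) ((1 - 'X) ^+ n : {poly R})`_k * (a + k%:R)^-1.
  have If k := Rintegral_beta1 (ak k).
  under eq_bigr => k _ do rewrite -(If k).2.
  rewrite -(@Rintegral_sumZ R _ _ _ _ (fun k : 'I_n.+1 => f k)) //; last first.
    by move=> k; exact: (If k).1.
  apply: eq_Rintegral => t; rewrite inE /= in_itv /= => /andP[t0 t1].
  have -> : t `^ (n.+1%:R - 1) = ((1 - 'X) ^+ n : {poly R}).[1 - t].
    by rewrite -natr1 addrK powR_mulrn ?ltW // horner_exp !hornerE subKr.
  rewrite (horner_coef_wide _ (size_1subXn n)) mulr_suml; apply: eq_bigr => k _.
  rewrite -mulrA /f -powR_mulrn ?subr_ge0 ?(ltW t1) //.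
  have t1' : 1 - t != 0 by rewrite gt_eqF ?subr_gt0.
  rewrite -powRD ?t1' ?implybT //.
  by congr (_ * _ `^ _); rewrite /a; ring.
rewrite (rmorph_sum (real_complex R)); apply: eq_bigr => k _.
by rewrite rmorphM /= coef_onem_complex fmorphV rmorphD rmorph_nat expr1.
Qed.

Lemma H_nat n k : H n.+1 k%:R x = \sum_(0 <= j < n.+1) (a%:C + j%:R) ^- k.
Proof.
rewrite /H big_add1 /=; apply: eq_big_nat => j _.
rewrite cpowNn; last by rewrite -natr1 -addrA [1 + x]addrC ltr_wpDl.
congr (_ ^- _); rewrite -natr1 /a !rmorphD rmorph1 rmorph_nat; ring.
Qed.

End TwoSeries.

Theorem proposition7 (R : realType) (p x : R) (s : R[i])
    (hp : 2 <= p) (hx : 0 < x + 1) (hs : 0 < complex.Re s) :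
  [/\ is_sum (fun n : nat => D (lambda s x) n%:R / (n%:R * p%:C ^+ n))
             (Z1 p s x),
      is_sum (fun n : nat =>
                (-1) ^+ n.+1 * H n s x / (n%:R * (p - 1)%:C ^+ n))
             (Z1 p s x)
    & forall m : nat, s = m%:R + 1 ->
      exists l : R[i],
        is_sum (fun n : nat =>
                  (Beta n%:R (1 + x))%:C / (n%:R * p%:C ^+ n)
                    * bell m (fun k : nat => H n k%:R x)) l
        /\ is_sum (fun n : nat =>
                  (-1) ^+ n.+1 * H n (m%:R + 1) x
                    / (n%:R * (p - 1)%:C ^+ n)) l].
Proof.
have sD := is_sum_D hp hx hs; have sH := is_sum_H hp hx hs.
split=> // m sE; exists (Z1 p s x); split; last by rewrite -sE.
apply: eq_is_sum sD => n.
rewrite (D_lambda_diff_pow hx hs n sE) (Beta_diff_pow hx).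
rewrite diff_pow_bell; last exact: complex_shift_neq0.
rewrite mulrAC; congr (_ * bell m _).
by apply/funext => k; rewrite H_nat.
Qed.
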